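(* Let $(X,E)$ be a locale, $S$ a nonempty finite set of states with interaction $\phi$, $\nu$ a probability measure on $S$ with $\nu(\{s\})>0$ for all $s\in S$, and $\mu=\nu^{\otimes X}$ the product measure on $S^X$. Let $G$ be a group acting on the locale $(X,E)$, and suppose that $G$ is torsion free and that the action of $G$ on $X$ is free. Then the boundary morphism $\delta\colon Z^1_{\mathrm{col}}(S^X)^G\to H^1(G,H^0_{\mathrm{col}}(S^X))$ induces an isomorphism \[ Z^1_{\mathrm{col}}(S^X)^G/\partial\bigl(C^0_{\mathrm{col}}(S^X)^G\bigr)\cong H^1(G,H^0_{\mathrm{col}}(S^X)). \] In particular, the choice of a set $\mathscr I_0$ of representatives of the $G$-orbits in the set of nonempty finite subsets of $X$ gives a splitting of the boundary morphism $\delta$, hence a decomposition \[ Z^1_{\mathrm{col}}(S^X)^G\cong \partial\bigl(C^0_{\mathrm{col}}(S^X)^G\bigr)\oplus H^1(G,H^0_{\mathrm{col}}(S^X)). \]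
   Context: **Setting.** A locale $(X,E)$ is a connected, locally finite, simple (no loops) symmetric directed graph with vertex set $X$ and edge set $E\subset X\times X$ (so $(x,y)\in E$ iff $(y,x)\in E$); $X$ is then countable. For $e=(o(e),t(e))\in E$ put $\bar e=(t(e),o(e))$. An interaction is a map $\phi\colon S\times S\to S\times S$ such that for every $(s_1,s_2)$ with $\phi(s_1,s_2)\ne(s_1,s_2)$ one has $\hat\imath\circ\phi\circ\hat\imath\circ\phi(s_1,s_2)=(s_1,s_2)$, where $\hat\imath$ exchanges the two components. For $\Lambda\subset X$ let $S^\Lambda=\prod_{x\in\Lambda}S$ and $E_\Lambda=E\cap(\Lambda\times\Lambda)$. For $\eta\in S^\Lambda$ and $e\in E_\Lambda$, $\eta^e\in S^\Lambda$ is defined by $(\eta^e_{o(e)},\eta^e_{t(e)})=\phi(\eta_{o(e)},\eta_{t(e)})$ and $\eta^e_x=\eta_x$ for $x\ne o(e),t(e)$. **Co-local functions.** $\mathscr I$ is the set of finite subsets of $X$, directed by inclusion. For $\Lambda\in\mathscr I$, $C(S^\Lambda)$ is the space of functions $S^\Lambda\to\mathbb R$; for $\Lambda\subset\Lambda'$, $C(S^\Lambda)\subset C(S^{\Lambda'})$ via pullback along the projection $\mathrm{pr}_\Lambda\colon S^{\Lambda'}\to S^\Lambda$. Write $\mu$ also for the pushforward of $\mu$ to $S^\Lambda$, and $\mu(\eta)=\mu(\{\eta\})$. For $\Lambda\subset\Lambda'$ in $\mathscr I$ the conditional expectation $\pi^\Lambda\colon C(S^{\Lambda'})\to C(S^\Lambda)$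 is $\pi^\Lambda f(\eta)=\frac1{\mu(\eta)}\sum_{\eta'\in S^{\Lambda'},\,\mathrm{pr}_\Lambda(\eta')=\eta}f(\eta')\mu(\eta')$. Put $C^0(S^\Lambda)=\{f\in C(S^\Lambda)\mid E_\mu[f]=0\}$ and $C^0_{\mathrm{col}}(S^X)=\varprojlim_{\Lambda\in\mathscr I}C^0(S^\Lambda)$, the projective limit along the maps $\pi^\Lambda$; equivalently, the families $(f^\Lambda)_{\Lambda\in\mathscr I}$ with $f^\Lambda\in C(S^\Lambda)$, $\pi^\Lambda f^{\Lambda'}=f^\Lambda$ for $\Lambda\subset\Lambda'$, and $f^\emptyset=0$. **Co-local forms.** $\Phi_\Lambda=\{(\eta,\eta^e)\mid\eta\in S^\Lambda,e\in E_\Lambda,\eta^e\ne\eta\}$. $C^1(S^\Lambda)$ is the space of functions $\omega\colon\Phi_\Lambda\to\mathbb R$ with $\omega(\eta',\eta)=-\omega(\eta,\eta')$. For $e\in E_\Lambda$ put $\omega_e(\eta)=\omega((\eta,\eta^e))$ if $\eta^e\neq\eta$ and $\omega_e(\eta)=0$ otherwise; this embeds $C^1(S^\Lambda)$ in $\prod_{e\in E_\Lambda}C(S^\Lambda)$. For $\Lambda\subset\Lambda'$, $\pi^\Lambda(\omega_e)_{e\in E_{\Lambda'}}=(\pi^\Lambda\omega_e)_{e\in E_\Lambda}$ defines $\pi^\Lambda\colon C^1(S^{\Lambda'})\to C^1(S^\Lambda)$. A form $\omega\in C^1(S^\Lambda)$ is closed if $\sum_{i=1}^N\omega(\eta^{i-1},\eta^i)=0$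 for every sequence $(\eta^0,\dots,\eta^N)$ in $S^\Lambda$ with $(\eta^{i-1},\eta^i)\in\Phi_\Lambda$ for all $i$ and $\eta^N=\eta^0$. $Z^1(S^\Lambda)$ is the space of closed forms; the $\pi^\Lambda$ preserve closed forms, and $Z^1_{\mathrm{col}}(S^X)=\varprojlim_{\Lambda\in\mathscr I}Z^1(S^\Lambda)$. The differential $\partial_\Lambda f(\eta,\eta')=f(\eta')-f(\eta)$ commutes with the $\pi^\Lambda$ and induces $\partial\colon C^0_{\mathrm{col}}(S^X)\to Z^1_{\mathrm{col}}(S^X)$, which is surjective. $H^0_{\mathrm{col}}(S^X)=\ker\partial$. **Group action.** $G$ acts on $(X,E)$ by graph automorphisms. For $\sigma\in G$ and $\eta\in S^\Lambda$, $\sigma(\eta)=(\eta_{\sigma^{-1}(x)})_{x\in\sigma(\Lambda)}\in S^{\sigma(\Lambda)}$; $\sigma(f)(\eta)=f(\sigma^{-1}(\eta))$ maps $C(S^\Lambda)$ to $C(S^{\sigma(\Lambda)})$, and $\sigma(\omega)(\varphi)=\omega(\sigma^{-1}(\varphi))$ maps forms on $S^\Lambda$ to forms on $S^{\sigma(\Lambda)}$. These are compatible with the $\pi^\Lambda$ and $\partial$, so $G$ acts on $C^0_{\mathrm{col}}(S^X)$, $Z^1_{\mathrm{col}}(S^X)$ and $H^0_{\mathrm{col}}(S^X)$ by $\sigma((f^\Lambda)_\Lambda)^{\sigma(\Lambda)}=\sigma(f^\Lambda)$. A superscript $G$ denotes invariants, and $H^1(G,-)$ is group cohomology. The boundary morphism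 $\delta$ is the connecting map of $0\to H^0_{\mathrm{col}}(S^X)\to C^0_{\mathrm{col}}(S^X)\xrightarrow{\partial}Z^1_{\mathrm{col}}(S^X)\to0$: it sends $\omega$ to the class of the cocycle $\rho(\sigma)=(1-\sigma)\theta$, where $\theta\in C^0_{\mathrm{col}}(S^X)$ satisfies $\partial\theta=\omega$. A splitting of $\delta$ is an $\mathbb R$-linear map $s\colon H^1(G,H^0_{\mathrm{col}}(S^X))\to Z^1_{\mathrm{col}}(S^X)^G$ with $\delta\circ s=\mathrm{id}$. *)

(* Defs.v *)
From HB Require Import structures.
From mathcomp Require Import all_boot all_order all_algebra.
From mathcomp Require Import finmap.
From mathcomp Require Import boolp classical_sets functions reals.

Set Implicit Arguments.
Unset Strict Implicit.
Unset Printing Implicit Defensive.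

Import Order.TTheory GRing.Theory Num.Theory.
Local Open Scope fset_scope.
Local Open Scope quotient_scope.
Local Open Scope ring_scope.

(** * Vector spaces: families, subspaces, quotients *)

Section Family.
Variables (R : pzRingType) (I : Type) (V : I -> lmodType R).

Definition family := forall i, V i.

HB.instance Definition _ := gen_eqMixin family.
HB.instance Definition _ := gen_choiceMixin family.

Let add (f g : family) : family := fun i => f i + g i.
Let opp (f : family) : family := fun i => - f i.
Let scale (a : R) (f : family) : family := fun i => a *: f i.
Let zero : family := fun i => 0.

Let addA : associative add.
Proof. by move=> f g h; apply: functional_extensionality_dep => i; exact: addrA. Qed.
Let addC : commutative add.
Proof. by move=> f g; apply: functional_extensionality_dep => i; exact: addrC. Qed.
Let add0 : left_id zero add.
Proof. by move=> f; apply: functional_extensionality_dep => i; exact: add0r. Qed.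
Let addN : left_inverse zero opp add.
Proof. by move=> f; apply: functional_extensionality_dep => i; exact: addNr. Qed.

HB.instance Definition _ := GRing.isZmodule.Build family addA addC add0 addN.

Let scaleA a b f : scale a (scale b f) = scale (a * b) f.
Proof. by apply: functional_extensionality_dep => i; exact: scalerA. Qed.
Let scale1 : left_id 1 scale.
Proof. by move=> f; apply: functional_extensionality_dep => i; exact: scale1r. Qed.
Let scaleDr : right_distributive scale +%R.
Proof. by move=> a f g; apply: functional_extensionality_dep => i; exact: scalerDr. Qed.
Let scaleDl f : {morph scale^~ f : a b / a + b}.
Proof. by move=> a b; apply: functional_extensionality_dep => i; exact: scalerDl. Qed.

HB.instance Definition _ :=
  GRing.Zmodule_isLmodule.Build R family scaleA scale1 scaleDr scaleDl.

Lemma family_addE (f g : family) i : (f + g) i = f i + g i. Proof. by []. Qed.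
Lemma family_scaleE a (f : family) i : (a *: f) i = a *: f i. Proof. by []. Qed.
Lemma family_0E i : (0 : family) i = 0. Proof. by []. Qed.

Lemma familyP (f g : family) : (forall i, f i = g i) -> f = g.
Proof. exact: functional_extensionality_dep. Qed.

End Family.

Section Subspace.
Variables (R : pzRingType) (V : lmodType R) (W : submodClosed V).

Record subspace := Subspace { inc : V ; _ : inc \in W }.

HB.instance Definition _ := [isSub for inc].
HB.instance Definition _ := [Choice of subspace by <:].
HB.instance Definition _ := [SubChoice_isSubLmodule of subspace by <:].

End Subspace.

Section Quotient.
Variables (R : pzRingType) (V : lmodType R) (W : submodClosed V).

Let W_pred : {pred V} := fun v => v \in W.
Let W_zmod_closed : zmod_closed W_pred.
Proof. exact: GRing.submod_closedB (submodClosedP W). Qed.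
HB.instance Definition _ := GRing.isZmodClosed.Build V W_pred W_zmod_closed.

Definition quotient := Quotient.quot W_pred.

HB.instance Definition _ := GRing.Zmodule.on quotient.

Definition qclass (v : V) : quotient := \pi_(Quotient.quot W_pred) v.

Lemma qclassP u v : qclass u = qclass v <-> u - v \in W.
Proof.
have E : (u - v \in W) = (qclass u == qclass v) := Quotient.idealrBE W_pred u v.
by rewrite E; split=> /eqP.
Qed.

Lemma qclass_surj (q : quotient) : exists v, qclass v = q.
Proof. by exists (repr (q : Quotient.quot W_pred)); exact: reprK. Qed.

Let qclassB u v : qclass (u - v) = qclass u - qclass v.
Proof. exact: (raddfB (\pi_(Quotient.quot W_pred))). Qed.

Let qclassD u v : qclass (u + v) = qclass u + qclass v.
Proof. exact: (raddfD (\pi_(Quotient.quot W_pred))). Qed.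

Let scale (a : R) (q : quotient) : quotient :=
  qclass (a *: repr (q : Quotient.quot W_pred)).

Let scaleE a v : scale a (qclass v) = qclass (a *: v).
Proof.
apply/qclassP; rewrite -scalerBr rpredZ //.
by apply/qclassP; exact: reprK.
Qed.

Let scaleA a b q : scale a (scale b q) = scale (a * b) q.
Proof. by have [v <-] := qclass_surj q; rewrite !scaleE scalerA. Qed.
Let scale1 : left_id 1 scale.
Proof. by move=> q; have [v <-] := qclass_surj q; rewrite !scaleE scale1r. Qed.
Let scaleDr : right_distributive scale +%R.
Proof.
move=> a p q; have [u <-] := qclass_surj p; have [v <-] := qclass_surj q.
by rewrite -qclassD !scaleE scalerDr qclassD.
Qed.
Let scaleDl q : {morph scale^~ q : a b / a + b}.
Proof.
by move=> a b; have [v <-] := qclass_surj q; rewrite !scaleE scalerDl qclassD.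
Qed.

HB.instance Definition _ :=
  GRing.Zmodule_isLmodule.Build R quotient scaleA scale1 scaleDr scaleDl.

Let qclass_linear : linear qclass.
Proof. by move=> a u v; rewrite qclassD -scaleE. Qed.
HB.instance Definition _ :=
  GRing.isLinear.Build R V quotient _ qclass qclass_linear.

End Quotient.

(** * Representations of a group and first cohomology *)

Section Cohomology.
Variables (R : pzRingType) (G : groupType).

Record gaction (V : lmodType R) := GAction {
  gact :> G -> {linear V -> V};
  gact1 : forall v, gact 1%g v = v;
  gactM : forall g h v, gact (g * h)%g v = gact g (gact h v)
}.

Variables (V : lmodType R) (A : gaction V).

Definition ginvariant : {pred V} := [pred v | `[< forall g, A g v = v >]].

Lemma ginvariantP v : reflect (forall g, A g v = v) (v \in ginvariant).
Proof. exact: asboolP. Qed.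

Let ginvariant_closed : submod_closed ginvariant.
Proof.
split=> [|a u v /ginvariantP uG /ginvariantP vG]; apply/ginvariantP => g.
  exact: linear0.
by rewrite linearP uG vG.
Qed.
HB.instance Definition _ :=
  GRing.isSubmodClosed.Build R V ginvariant
    (GRing.submod_closed_semi ginvariant_closed).

Definition cocycle : {pred G -> V} :=
  [pred r : G -> V | `[< forall g h, r (g * h)%g = r g + A g (r h) >]].

Lemma cocycleP r :
  reflect (forall g h, r (g * h)%g = r g + A g (r h)) (r \in cocycle).
Proof. exact: asboolP. Qed.

Let cocycle_closed : submod_closed cocycle.
Proof.
split=> [|a r s /cocycleP rP /cocycleP sP]; apply/cocycleP => g h.
  by rewrite linear0 addr0.
by rewrite !(addrfctE, scalrfctE) linearP rP sP scalerDr addrACA.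
Qed.
HB.instance Definition _ :=
  GRing.isSubmodClosed.Build R (G -> V) cocycle
    (GRing.submod_closed_semi cocycle_closed).

Definition coboundary : {pred subspace cocycle} :=
  [pred r | `[< exists v, forall g, inc r g = v - A g v >]].

Lemma coboundaryP r :
  reflect (exists v, forall g, inc r g = v - A g v) (r \in coboundary).
Proof. exact: asboolP. Qed.

Let coboundary_closed : submod_closed coboundary.
Proof.
split=> [|a r s /coboundaryP[u rE] /coboundaryP[v sE]]; apply/coboundaryP.
  by exists 0 => g; rewrite linear0 subr0.
exists (a *: u + v) => g; have -> : inc (a *: r + s) = a *: inc r + inc s by [].
by rewrite !(addrfctE, scalrfctE) rE sE linearP scalerBr opprD addrACA.
Qed.
HB.instance Definition _ :=
  GRing.isSubmodClosed.Build R (subspace cocycle) coboundary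
    (GRing.submod_closed_semi coboundary_closed).

Definition H1 := quotient coboundary.
HB.instance Definition _ := GRing.Lmodule.on H1.

End Cohomology.

Arguments ginvariant {R G V} A v.
Arguments cocycle {R G V} A r.
Arguments coboundary {R G V} A r.

Section SubAction.
Variables (R : pzRingType) (G : groupType) (V : lmodType R) (A : gaction G V).
Variables (W : submodClosed V) (W_stable : forall g v, v \in W -> A g v \in W).

Definition sub_gact (g : G) (w : subspace W) : subspace W :=
  Subspace (W_stable g (valP w)).

Let sub_gact_linear g : linear (sub_gact g).
Proof. by move=> a u v; apply: val_inj; rewrite /= linearP. Qed.
HB.instance Definition _ g :=
  GRing.isLinear.Build R (subspace W) (subspace W) _ (sub_gact g)
    (sub_gact_linear g).

Let sub_gact1 w : sub_gact 1%g w = w.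
Proof. by apply: val_inj; rewrite /= gact1. Qed.
Let sub_gactM g h w : sub_gact (g * h)%g w = sub_gact g (sub_gact h w).
Proof. by apply: val_inj; rewrite /= gactM. Qed.

Definition sub_gaction : gaction G (subspace W) :=
  @GAction R G (subspace W) sub_gact sub_gact1 sub_gactM.

End SubAction.

Section Kernel.
Variables (R : pzRingType) (U V : lmodType R) (d : {linear U -> V}).

Definition ker : {pred U} := [pred u | d u == 0].

Lemma kerP u : reflect (d u = 0) (u \in ker).
Proof. exact: eqP. Qed.

Let ker_closed : submod_closed ker.
Proof.
split=> [|a u v /kerP du /kerP dv]; apply/kerP; first exact: linear0.
by rewrite linearP du dv scaler0 addr0.
Qed.
HB.instance Definition _ :=
  GRing.isSubmodClosed.Build R U ker (GRing.submod_closed_semi ker_closed).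

End Kernel.

Section Connecting.
Variables (R : pzRingType) (G : groupType) (U V : lmodType R).
Variables (A : gaction G U) (B : gaction G V) (d : {linear U -> V}).
Hypothesis d_equivariant : forall g u, d (A g u) = B g (d u).

Lemma ker_stable g u : u \in ker d -> A g u \in ker d.
Proof. by move=> /kerP du; apply/kerP; rewrite d_equivariant du linear0. Qed.

Definition ker_gaction : gaction G (subspace (ker d)) :=
  sub_gaction ker_stable.

(* d(U^G), inside V^G *)
Definition image_invariant : {pred subspace (ginvariant B)} :=
  [pred w | `[< exists2 u, u \in ginvariant A & d u = inc w >]].

Lemma image_invariantP w : reflect
  (exists2 u, u \in ginvariant A & d u = inc w) (w \in image_invariant).
Proof. exact: asboolP. Qed.

Let image_invariant_closed : submod_closed image_invariant.
Proof.
split=> [|a v w /image_invariantP[f fG fv] /image_invariantP[g gG gw]];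
  apply/image_invariantP.
  by exists 0; [exact: rpred0 | exact: linear0].
exists (a *: f + g); first by rewrite rpredD // rpredZ.
by rewrite linearP fv gw.
Qed.
HB.instance Definition _ :=
  GRing.isSubmodClosed.Build R (subspace (ginvariant B)) image_invariant
    (GRing.submod_closed_semi image_invariant_closed).

(* delta is the connecting map V^G -> H^1(G, ker d): it sends w to the class of
   the cocycle g |-> (1 - g) theta, for any theta in U with d theta = w. *)
Definition is_boundary (delta : subspace (ginvariant B) -> H1 ker_gaction) :=
  forall w,
    (exists theta, d theta = inc w) /\
    (forall theta, d theta = inc w ->
       exists2 rho : subspace (cocycle ker_gaction),
         forall g, inc (inc rho g) = theta - A g theta &
         delta w = qclass (coboundary ker_gaction) rho).

End Connecting.

Arguments image_invariant {R G U V} A B d w.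
Arguments ker_gaction {R G U V A B d}.
Arguments is_boundary {R G U V A B d}.

(** * Locales, interactions, configurations *)

Record locale (X : choiceType) := Locale {
  edge :> rel X;
  edge_sym : symmetric edge;
  edge_irr : irreflexive edge;
  edge_locally_finite :
    forall x, exists A : {fset X}, forall y, edge x y -> y \in A;
  edge_connected : forall x y, exists2 p : seq X, path edge x p & last x p = y
}.

Definition swap (S : Type) (s : S * S) : S * S := (s.2, s.1).

Record interaction (S : Type) := Interaction {
  imap :> S * S -> S * S;
  imapK : forall s, imap s <> s -> swap (imap (swap (imap s))) = s
}.

Record full_prob (R : numDomainType) (S : finType) := FullProb {
  pmass :> S -> R;
  pmass_gt0 : forall s, 0 < pmass s;
  pmass_sum1 : \sum_s pmass s = 1
}.

Record locale_action (G : groupType) (X : choiceType) (E : locale X) :=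
  LocaleAction {
  lact :> G -> X -> X;
  lact1 : forall x, lact 1%g x = x;
  lactM : forall g h x, lact (g * h)%g x = lact g (lact h x);
  lact_edge : forall g x y, E (lact g x) (lact g y) = E x y
}.

Definition torsion_free (G : groupType) :=
  forall (g : G) (n : nat), (0 < n)%N -> (g ^+ n)%g = 1%g -> g = 1%g.

Definition free_action (G : groupType) (X : choiceType) (E : locale X)
    (act : locale_action G E) :=
  forall g x, act g x = x -> g = 1%g.

Section Configurations.
Variables (X : choiceType) (E : locale X) (S : finType) (phi : interaction S).
Implicit Types L : {fset X}.

Definition conf L := {ffun L -> S}.

Definition pr L L' (h : L `<=` L') (eta : conf L') : conf L :=
  [ffun x => eta (fincl h x)].

Definition edge_in L (e : L * L) := E (val e.1) (val e.2).

Definition edge_incl L L' (h : L `<=` L') (e : L * L) : L' * L' :=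
  (fincl h e.1, fincl h e.2).

Definition emove L (e : L * L) (eta : conf L) : conf L :=
  [ffun z => if z == e.1 then (phi (eta e.1, eta e.2)).1
             else if z == e.2 then (phi (eta e.1, eta e.2)).2
             else eta z].

Definition transition L (eta eta' : conf L) : bool :=
  [exists e : L * L,
    [&& edge_in e, emove e eta != eta & eta' == emove e eta]].

Lemma edge_in_neq L (e : L * L) : edge_in e -> e.1 != e.2.
Proof.
by rewrite /edge_in; apply: contraTneq => ->; rewrite edge_irr.
Qed.

Lemma pr_move L L' (h : L `<=` L') (e : L * L) (eta : conf L') :
  pr h (emove (edge_incl h e) eta) = emove e (pr h eta).
Proof. by apply/ffunP => x; rewrite !ffunE /= !(inj_eq (@fincl_inj _ _ _ h)). Qed.

End Configurations.

Section Measure.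
Variables (R : realFieldType) (X : choiceType) (S : finType).
Variable nu : full_prob R S.
Implicit Types L : {fset X}.

(* The mass of {eta} under the marginal on S^L of the product measure on S^X;
   only these finite marginals ever occur. *)
Definition mu L (eta : conf S L) : R := \prod_x nu (eta x).

Definition expect L (f : conf S L -> R) : R := \sum_eta f eta * mu eta.

Definition condexp L L' (h : L `<=` L') (f : conf S L' -> R)
    (eta : conf S L) : R :=
  (mu eta)^-1 * \sum_(eta' | pr h eta' == eta) f eta' * mu eta'.

Lemma mu_gt0 L (eta : conf S L) : 0 < mu eta.
Proof. by apply: prodr_gt0 => x _; apply: pmass_gt0. Qed.

Let mu_out L L' (eta' : conf S L') : R :=
  \prod_(z : L' | val z \notin L) nu (eta' z).

Let mu_split L L' (h : L `<=` L') (eta' : conf S L') :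
  mu eta' = mu (pr h eta') * mu_out L eta'.
Proof.
rewrite /mu (bigID (fun z : L' => val z \in L)) /=; congr (_ * _).
have E : [set z : L' | val z \in L] = [set fincl h x | x in [set: L]]%SET.
  apply/setP => z; rewrite !inE; apply/idP/imsetP => [zL|[x _ ->]].
    by exists [` zL]; rewrite ?inE//; apply: val_inj.
  exact: (valP x).
transitivity (\prod_(z in [set z : L' | val z \in L]) nu (eta' z)).
  by apply: eq_bigl => z; rewrite inE.
rewrite E big_imset /=; last by move=> x y _ _; apply: fincl_inj.
by apply: eq_big => [x|x _]; rewrite ?inE ?ffunE.
Qed.

Let condexpE L L' (h : L `<=` L') f (eta : conf S L) :
  condexp h f eta = \sum_(eta' | pr h eta' == eta) f eta' * mu_out L eta'.
Proof.
rewrite /condexp big_distrr; apply: eq_bigr => eta' /eqP <- /=.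
by rewrite (mu_split h) [f _ * _]mulrCA mulKf ?gt_eqF ?mu_gt0.
Qed.

Let glue L L' (eta : conf S L) (zeta : conf S L') : conf S L' :=
  [ffun z => if insub (val z) is Some x then eta x else zeta z].

Let glueE L L' (h : L `<=` L') (eta : conf S L) (zeta : conf S L') x :
  glue eta zeta (fincl h x) = eta x.
Proof.
rewrite ffunE; case: insubP => [y _ yx|]; first by congr (eta _); apply: val_inj.
by rewrite /= (valP x).
Qed.

Let pr_glue L L' (h : L `<=` L') (eta : conf S L) (zeta : conf S L') :
  pr h (glue eta zeta) = eta.
Proof. by apply/ffunP => x; rewrite ffunE glueE. Qed.

Variables (E : locale X) (phi : interaction S).

Lemma condexp_move L L' (h : L `<=` L') (e : L * L) f (eta : conf S L) :
  condexp h f (emove phi e eta) =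
  condexp h (fun eta' => f (emove phi (edge_incl h e) eta')) eta.
Proof.
set e' := edge_incl h e; rewrite !condexpE.
have out z : val z \notin L -> (z != e'.1) * (z != e'.2).
  by move=> zL; split; apply: contraNneq zL => -> /=; apply: valP.
rewrite (reindex_onto (emove phi e') (glue eta)) /=; last first.
  move=> zeta /eqP zE; apply/ffunP => z; rewrite ffunE.
  have gE := glueE h eta zeta.
  have [zL|zL] := boolP (val z \in L); last first.
    rewrite !(negbTE (out z zL).1, negbTE (out z zL).2) ffunE.
    by rewrite insubF // (negbTE zL).
  have -> : z = fincl h [` zL] by apply: val_inj.
  have H := congr1 (fun c : conf S L => c [` zL]) zE.
  rewrite !ffunE in H; rewrite H.
  have q x y : (fincl h x == fincl h y) = (x == y).
    exact: inj_eq (@fincl_inj _ _ _ h) x y.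
  rewrite (q _ e.1 : (_ == e'.1) = _) (q _ e.2 : (_ == e'.2) = _).
  by rewrite (gE e.1 : glue _ _ e'.1 = _) (gE e.2 : glue _ _ e'.2 = _) gE.
apply: eq_big => [eta'|eta' /andP[_ /eqP gE]]; last first.
  congr (_ * _); apply: eq_bigr => z zL; rewrite ffunE.
  by rewrite !(negbTE (out z zL).1, negbTE (out z zL).2).
apply/andP/eqP => [[_ /eqP <-]|prE]; first exact: pr_glue.
rewrite pr_move prE; split=> //; apply/eqP/ffunP => z; rewrite ffunE.
case: insubP => [y _ yz|zL].
  by rewrite -prE ffunE; congr (eta' _); apply: val_inj.
by rewrite ffunE !(negbTE (out z zL).1, negbTE (out z zL).2).
Qed.

Lemma condexpB L L' (h : L `<=` L') (f g : conf S L' -> R) eta :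
  condexp h (fun eta' => f eta' - g eta') eta =
  condexp h f eta - condexp h g eta.
Proof.
rewrite /condexp -mulrBr -sumrB; congr (_ * _).
by apply: eq_bigr => eta' _; rewrite mulrBl.
Qed.

Lemma eq_condexp L L' (h : L `<=` L') (f g : conf S L' -> R) eta :
  f =1 g -> condexp h f eta = condexp h g eta.
Proof. by move=> fg; congr (_ * _); apply: eq_bigr => eta' _; rewrite fg. Qed.

Lemma condexpP L L' (h : L `<=` L') a (f g : conf S L' -> R) eta :
  condexp h (fun eta' => a * f eta' + g eta') eta =
  a * condexp h f eta + condexp h g eta.
Proof.
rewrite /condexp mulrCA -mulrDr; congr (_ * _).
rewrite big_distrr -big_split; apply: eq_bigr => eta' _ /=.
by rewrite mulrDl mulrA.
Qed.

Lemma expectP L a (f g : conf S L -> R) :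
  expect (fun eta => a * f eta + g eta) = a * expect f + expect g.
Proof.
rewrite /expect big_distrr -big_split; apply: eq_bigr => eta _ /=.
by rewrite mulrDl mulrA.
Qed.

End Measure.

(** * Co-local functions and forms *)

Section Colocal.
Variables (R : realFieldType) (X : choiceType) (E : locale X).
Variables (S : finType) (phi : interaction S) (nu : full_prob R S).
Implicit Types L : {fset X}.

Definition cochain0 :=
  family (fun L : {fset X} => (conf S L -> R^o) : lmodType R).
HB.instance Definition _ := GRing.Lmodule.on cochain0.

Definition cochain1 :=
  family (fun L : {fset X} => (conf S L -> conf S L -> R^o) : lmodType R).
HB.instance Definition _ := GRing.Lmodule.on cochain1.

Definition C0col : {pred cochain0} := [pred f : cochain0 | `[<
  (forall L, expect nu (f L) = 0) /\
  (forall L L' (h : L `<=` L'), condexp nu h (f L') =1 f L) >]].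

(* C^1(S^L): functions on Phi_L, extended by 0 to S^L x S^L; with this
   convention w eta (emove phi e eta) is the component w_e at eta, including
   when eta^e = eta. *)
Definition is_form L (w : conf S L -> conf S L -> R) :=
  (forall eta eta', ~~ transition E phi eta eta' -> w eta eta' = 0) /\
  (forall eta eta', w eta' eta = - w eta eta').

Definition is_closed L (w : conf S L -> conf S L -> R) :=
  forall (N : nat) (s : nat -> conf S L),
    (forall i, (i < N)%N -> transition E phi (s i) (s i.+1)) -> s N = s 0%N ->
    \sum_(i < N) w (s i) (s i.+1) = 0.

Definition component L (w : conf S L -> conf S L -> R) (e : L * L)
    (eta : conf S L) : R := w eta (emove phi e eta).

Definition Z1col : {pred cochain1} := [pred w : cochain1 | `[<
  [/\ forall L, is_form (w L),
      forall L, is_closed (w L) &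
      forall L L' (h : L `<=` L') (e : L * L), edge_in E e ->
        condexp nu h (component (w L') (edge_incl h e)) =1 component (w L) e] >]].

Lemma C0colP f : reflect
  ((forall L, expect nu (f L) = 0) /\
   (forall L L' (h : L `<=` L'), condexp nu h (f L') =1 f L)) (f \in C0col).
Proof. exact: asboolP. Qed.

Lemma Z1colP w : reflect
  [/\ forall L, is_form (w L),
      forall L, is_closed (w L) &
      forall L L' (h : L `<=` L') (e : L * L), edge_in E e ->
        condexp nu h (component (w L') (edge_incl h e)) =1 component (w L) e]
  (w \in Z1col).
Proof. exact: asboolP. Qed.

Let lin0E a (f g : cochain0) L eta :
  (a *: f + g) L eta = a * f L eta + g L eta.
Proof. by []. Qed.

Let lin1E a (v w : cochain1) L eta eta' :
  (a *: v + w) L eta eta' = a * v L eta eta' + w L eta eta'.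
Proof. by []. Qed.

Let C0col_closed : submod_closed C0col.
Proof.
split=> [|a f g /C0colP[f0 fc] /C0colP[g0 gc]]; apply/C0colP; split.
- by move=> L; rewrite /expect big1 // => eta _; rewrite mul0r.
- move=> L L' h eta; rewrite /condexp big1 ?mulr0 // => eta' _.
  by rewrite mul0r.
- move=> L; transitivity (a * expect nu (f L) + expect nu (g L)).
    exact: expectP.
  by rewrite f0 g0 mulr0 addr0.
- move=> L L' h eta; rewrite lin0E -(fc _ _ h) -(gc _ _ h).
  exact: condexpP.
Qed.
HB.instance Definition _ :=
  GRing.isSubmodClosed.Build R cochain0 C0col
    (GRing.submod_closed_semi C0col_closed).

Let Z1col_closed : submod_closed Z1col.
Proof.
split=> [|a v w /Z1colP[vf vz vc] /Z1colP[wf wz wc]]; apply/Z1colP; split.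
- by move=> L; split=> // eta eta'; rewrite [RHS]oppr0.
- by move=> L N s _ _; rewrite big1.
- move=> L L' h e _ eta; rewrite /condexp big1 ?mulr0 // => eta' _.
  by rewrite [component _ _ _](_ : _ = 0) // mul0r.
- move=> L; have [v0 vN] := vf L; have [w0 wN] := wf L; split=> eta eta'.
    by move=> n; rewrite lin1E v0 // w0 // mulr0 addr0.
  by rewrite !lin1E vN wN mulrN opprD.
- move=> L N s sP sN.
  rewrite (eq_bigr (fun i : 'I_N =>
    a * v L (s i) (s i.+1) + w L (s i) (s i.+1))) //.
  by rewrite big_split -big_distrr /= vz // wz // mulr0 addr0.
- move=> L L' h e eE eta.
  rewrite [RHS]lin1E -/(component (v L) e eta) -/(component (w L) e eta).
  rewrite -(vc _ _ h _ eE) -(wc _ _ h _ eE); exact: condexpP.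
Qed.
HB.instance Definition _ :=
  GRing.isSubmodClosed.Build R cochain1 Z1col
    (GRing.submod_closed_semi Z1col_closed).

Lemma fpowerset_sub L (L' : fpowerset L) : val L' `<=` L.
Proof. by rewrite -fpowersetE (valP L'). Qed.

(* The part f_L of f in the decomposition f^L = \sum_(L' `<=` L) f_L', where
   f_L in C(S^L) is killed by the conditional expectation to every proper
   subset of L (Moebius inversion over the subsets of L).  A family in C0col is
   determined by its parts f_L, L nonempty, which can be chosen freely. *)
Definition local_part (f : cochain0) L (eta : conf S L) : R :=
  \sum_(L' : fpowerset L)
    (-1) ^+ #|` L `\` val L'| * f (val L') (pr (fpowerset_sub L') eta).

Definition dfam (f : cochain0) : cochain1 := fun L eta eta' =>
  if transition E phi eta eta' then f L eta' - f L eta else 0.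

Arguments dfam : clear implicits.

Let transition_sym L (eta eta' : conf S L) :
  transition E phi eta eta' -> transition E phi eta' eta.
Proof.
case/existsP => e /and3P[eE ne /eqP ->]; apply/existsP; exists (swap e).
have n12 := edge_in_neq eE.
set p := (eta e.1, eta e.2); set q := phi p.
have Q : q <> p.
  move=> qp; case/eqP: ne; apply/ffunP => z; rewrite ffunE -/p -/q qp.
  by case: eqP => [->|_] //; case: eqP => [->|].
have mE1 : emove phi e eta e.1 = q.1 by rewrite ffunE eqxx.
have mE2 : emove phi e eta e.2 = q.2.
  by rewrite ffunE eq_sym (negbTE n12) eqxx.
have bk : emove phi (swap e) (emove phi e eta) = eta.
  apply/ffunP => z; rewrite ffunE /= mE1 mE2.
  have -> : phi (q.2, q.1) = swap p.
    by rewrite -[in RHS](imapK Q) -/q /swap; case: (phi _).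
  rewrite /=; case: (eqVneq z e.2) => [->//|z2].
  case: (eqVneq z e.1) => [->//|z1].
  by rewrite ffunE (negbTE z1) (negbTE z2).
by rewrite bk eqxx eq_sym ne /edge_in /= edge_sym -/(edge_in E e) eE.
Qed.

Lemma dfam_component (f : cochain0) L (e : L * L) : edge_in E e ->
  component (dfam f L) e =1 fun eta => f L (emove phi e eta) - f L eta.
Proof.
move=> eE eta; rewrite /component /dfam; case: ifPn => // /existsPn/(_ e).
by rewrite eE eqxx andbT /= negbK => /eqP ->; rewrite subrr.
Qed.

Let dfam_Z1col (f : subspace C0col) : dfam (inc f) \in Z1col.
Proof.
have /C0colP[_ fc] := valP f; apply/Z1colP; split.
- move=> L; split=> eta eta'; rewrite /dfam; first by move/negbTE => ->.
  have -> : transition E phi eta' eta = transition E phi eta eta'.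
    by apply/idP/idP; apply: transition_sym.
  by case: ifP; rewrite ?oppr0 // opprB.
- move=> L N s sP sN.
  rewrite (eq_bigr (fun i : 'I_N => inc f L (s i.+1) - inc f L (s i))).
    rewrite -(big_mkord xpredT (fun i => inc f L (s i.+1) - inc f L (s i))).
    by rewrite (telescope_sumr (fun i => inc f L (s i))) // sN subrr.
  by move=> i _; rewrite /dfam sP.
- move=> L L' h e eE eta; rewrite dfam_component // -!(fc _ _ h).
  rewrite condexp_move -condexpB; apply: eq_condexp => eta'.
  exact: dfam_component.
Qed.

Definition dcol (f : subspace C0col) : subspace Z1col :=
  Subspace (dfam_Z1col f).

Let dcol_linear : linear dcol.
Proof.
move=> a f g; apply: val_inj; apply: familyP => L.
apply/funext => eta; apply/funext => eta'.
rewrite [RHS]lin1E /= /dfam; case: ifP => _; last by rewrite mulr0 addr0.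
by rewrite mulrBr addrACA -opprD.
Qed.
HB.instance Definition _ :=
  GRing.isLinear.Build R (subspace C0col) (subspace Z1col) _ dcol dcol_linear.

End Colocal.

Arguments local_part {R X S} f L eta.
Arguments dcol {R X} E {S} phi nu f.

(** * The action of G *)

Section ConfAction.
Variables (X : choiceType) (E : locale X) (G : groupType).
Variable act : locale_action G E.
Implicit Types L : {fset X}.

Definition gset (g : G) L : {fset X} := [fset act g x | x in L].

Lemma lactK g : cancel (act g) (act g^-1%g).
Proof. by move=> x; rewrite -lactM mulVg lact1. Qed.

Lemma lactVK g : cancel (act g^-1%g) (act g).
Proof. by move=> x; rewrite -lactM mulgV lact1. Qed.

Lemma mem_gset g L y : (y \in gset g L) = (act g^-1%g y \in L).
Proof.
apply/imfsetP/idP => [[x xL ->]|yL]; first by rewrite lactK.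
by exists (act g^-1%g y); rewrite ?lactVK.
Qed.

Lemma mem_gsetV g L (y : gset g L) : act g^-1%g (val y) \in L.
Proof. by rewrite -mem_gset (valP y). Qed.

Lemma mem_gset_act g L (x : L) : act g (val x) \in gset g L.
Proof. by rewrite mem_gset lactK (valP x). Qed.

Lemma gset1 L : gset 1%g L = L.
Proof. by apply/fsetP => y; rewrite mem_gset invg1 lact1. Qed.

Lemma gsetM g h L : gset (g * h)%g L = gset g (gset h L).
Proof. by apply/fsetP => y; rewrite !mem_gset invgM lactM. Qed.

Lemma gsetS g L L' : L `<=` L' -> gset g L `<=` gset g L'.
Proof.
by move=> h; apply/fsubsetP => y; rewrite !mem_gset => /(fsubsetP h).
Qed.

Variables (S : finType) (phi : interaction S).

Definition gconf g L (eta : conf S L) : conf S (gset g L) :=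
  [ffun y => eta [` mem_gsetV y]].

Let fw g L (x : L) : gset g L := [` mem_gset_act g x].
Let bk g L (y : gset g L) : L := [` mem_gsetV y].

Let fwK g L : cancel (@fw g L) (@bk g L).
Proof. by move=> x; apply: val_inj; rewrite /= lactK. Qed.
Let bkK g L : cancel (@bk g L) (@fw g L).
Proof. by move=> x; apply: val_inj; rewrite /= lactVK. Qed.

Let gback g L (zeta : conf S (gset g L)) : conf S L :=
  [ffun x => zeta (fw g x)].

Let gconfK g L : cancel (@gconf g L) (@gback g L).
Proof.
by move=> eta; apply/ffunP => x; rewrite !ffunE -/(bk _) fwK.
Qed.
Let gbackK g L : cancel (@gback g L) (@gconf g L).
Proof.
by move=> eta; apply/ffunP => x; rewrite !ffunE -/(bk _) bkK.
Qed.

Lemma gconf_bij g L : bijective (@gconf g L).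
Proof. exact: Bijective (@gconfK g L) (@gbackK g L). Qed.

Let gedge g L (e : L * L) : gset g L * gset g L := (fw g e.1, fw g e.2).

Let gedge_in g L (e : L * L) : edge_in E (gedge g e) = edge_in E e.
Proof. exact: lact_edge. Qed.

Let move_gedge g L (e : L * L) (eta : conf S L) :
  emove phi (gedge g e) (gconf g eta) = gconf g (emove phi e eta).
Proof.
apply/ffunP => y; rewrite !ffunE -!/(bk _) !fwK -[y in LHS]bkK.
by rewrite /gedge /= !(inj_eq (can_inj (@fwK g L))) bkK.
Qed.

Lemma transition_gconf g L (eta eta' : conf S L) :
  transition E phi (gconf g eta) (gconf g eta') = transition E phi eta eta'.
Proof.
have gE := inj_eq (bij_inj (gconf_bij g L)).
apply/existsP/existsP => -[e /and3P[]].
  have -> : e = gedge g (bk e.1, bk e.2).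
    by rewrite /gedge /= !bkK; case: (e).
  rewrite gedge_in move_gedge !gE => *; exists (bk e.1, bk e.2).
  by apply/and3P; split.
move=> *; exists (gedge g e); rewrite gedge_in move_gedge !gE.
by apply/and3P; split.
Qed.

Lemma pr_gconf g L L' (h : L `<=` L') (eta : conf S L') :
  pr (gsetS g h) (gconf g eta) = gconf g (pr h eta).
Proof.
by apply/ffunP => y; rewrite !ffunE; congr (eta _); apply: val_inj.
Qed.

Variables (R : realFieldType) (nu : full_prob R S).

Lemma mu_gconf g L (eta : conf S L) : mu nu (gconf g eta) = mu nu eta.
Proof.
rewrite /mu [RHS](reindex (@bk g L)) /=.
  by apply: eq_bigr => y _; rewrite ffunE.
by apply: onW_bij; exact: Bijective (@bkK g L) (@fwK g L).
Qed.

Let condexp_gconf g L L' (h : L `<=` L') f (eta : conf S L) :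
  condexp nu (gsetS g h) f (gconf g eta) =
  condexp nu h (fun eta' => f (gconf g eta')) eta.
Proof.
rewrite /condexp mu_gconf; congr (_ * _).
rewrite (reindex (@gconf g L')) /=; last exact: onW_bij (gconf_bij g L').
apply: eq_big => [eta'|eta' _]; last by rewrite mu_gconf.
by rewrite pr_gconf (inj_eq (bij_inj (gconf_bij g L))).
Qed.

(* sigma(f)^L = sigma(f^{sigma^-1 L}), where sigma(f)(eta) = f(sigma^-1 eta) *)
Definition act0 (g : G) (f : cochain0 R X S) : cochain0 R X S :=
  fun L eta => f (gset g^-1%g L) (gconf g^-1%g eta).

Definition act1 (g : G) (w : cochain1 R X S) : cochain1 R X S :=
  fun L eta eta' =>
    w (gset g^-1%g L) (gconf g^-1%g eta) (gconf g^-1%g eta').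

Arguments act0 : clear implicits.
Arguments act1 : clear implicits.

Let act0_linear g : linear (act0 g).
Proof. by []. Qed.
HB.instance Definition _ g :=
  GRing.isLinear.Build R (cochain0 R X S) (cochain0 R X S) _ (act0 g)
    (act0_linear g).

Let act1_linear g : linear (act1 g).
Proof. by []. Qed.
HB.instance Definition _ g :=
  GRing.isLinear.Build R (cochain1 R X S) (cochain1 R X S) _ (act1 g)
    (act1_linear g).

Let conf_eq (T : Type) L1 L2 (f : forall L, conf S L -> conf S L -> T)
    (a1 b1 : conf S L1) (a2 b2 : conf S L2) :
  L1 = L2 ->
  (forall x (x1 : x \in L1) (x2 : x \in L2), a1 [` x1] = a2 [` x2]) ->
  (forall x (x1 : x \in L1) (x2 : x \in L2), b1 [` x1] = b2 [` x2]) ->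
  f L1 a1 b1 = f L2 a2 b2.
Proof.
move=> L12; case: L2 / L12 a2 b2 => a2 b2 aE bE.
by congr (f _ _ _); apply/ffunP => -[x xL].
Qed.

Let gconf1 L (eta : conf S L) x (x1 : x \in gset 1^-1%g L) (x2 : x \in L) :
  gconf 1^-1%g eta [` x1] = eta [` x2].
Proof.
by rewrite ffunE; congr (eta _); apply: val_inj; rewrite /= !invg1 lact1.
Qed.

Let gconfM g h L (eta : conf S L) x (x1 : x \in gset (g * h)^-1%g L)
    (x2 : x \in gset h^-1%g (gset g^-1%g L)) :
  gconf (g * h)^-1%g eta [` x1] = gconf h^-1%g (gconf g^-1%g eta) [` x2].
Proof.
rewrite !ffunE; congr (eta _); apply: val_inj.
by rewrite /= !invgK lactM.
Qed.

Let act0_1 f : act0 1%g f = f.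
Proof.
apply: familyP => L; apply/funext => eta.
apply: (conf_eq (fun L a _ => f L a) (b1 := gconf _ eta)); first last.
- exact: gconf1.
- exact: gconf1.
- by rewrite invg1 gset1.
Qed.

Let act0_M g h f : act0 (g * h)%g f = act0 g (act0 h f).
Proof.
apply: familyP => L; apply/funext => eta.
apply: (conf_eq (fun L a _ => f L a)
  (b1 := gconf _ eta) (b2 := gconf _ (gconf _ eta))); first last.
- exact: gconfM.
- exact: gconfM.
- by rewrite invgM gsetM.
Qed.

Let act1_1 w : act1 1%g w = w.
Proof.
apply: familyP => L; apply/funext => eta; apply/funext => eta'.
apply: (conf_eq w); first by rewrite invg1 gset1.
- exact: gconf1.
- exact: gconf1.
Qed.

Let act1_M g h w : act1 (g * h)%g w = act1 g (act1 h w).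
Proof.
apply: familyP => L; apply/funext => eta; apply/funext => eta'.
apply: (conf_eq w); first by rewrite invgM gsetM.
- exact: gconfM.
- exact: gconfM.
Qed.

Let gconfVK g L (eta : conf S L) x (x1 : x \in gset g^-1%g (gset g L))
    (x2 : x \in L) : gconf g^-1%g (gconf g eta) [` x1] = eta [` x2].
Proof.
by rewrite !ffunE; congr (eta _); apply: val_inj; rewrite /= invgK lactK.
Qed.

Let gsetVK g L : gset g^-1%g (gset g L) = L.
Proof. by rewrite -gsetM mulVg gset1. Qed.

Lemma act0E g f L (eta : conf S L) : act0 g f (gset g L) (gconf g eta) = f L eta.
Proof.
apply: (conf_eq (fun L a _ => f L a)
  (b1 := gconf g^-1%g (gconf g eta)) (b2 := eta) (gsetVK g L)).
- exact: gconfVK.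
- exact: gconfVK.
Qed.

Lemma act1E g w L (eta eta' : conf S L) :
  act1 g w (gset g L) (gconf g eta) (gconf g eta') = w L eta eta'.
Proof.
apply: (conf_eq w (gsetVK g L)).
- exact: gconfVK.
- exact: gconfVK.
Qed.

Definition gact_cochain0 : gaction G (cochain0 R X S) :=
  @GAction R G (cochain0 R X S) act0 act0_1 act0_M.

Definition gact_cochain1 : gaction G (cochain1 R X S) :=
  @GAction R G (cochain1 R X S) act1 act1_1 act1_M.

Lemma C0col_stable g f : f \in C0col nu -> gact_cochain0 g f \in C0col nu.
Proof.
move=> /C0colP[f0 fc]; apply/C0colP; split=> [L|L L' h eta].
  rewrite -[RHS](f0 (gset g^-1%g L)) /expect.
  rewrite [RHS](reindex (@gconf g^-1%g L)) /=.
    by apply: eq_bigr => eta _; rewrite mu_gconf.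
  exact: onW_bij (gconf_bij _ _).
rewrite [RHS]/= /act0 -(fc _ _ (gsetS g^-1%g h)) condexp_gconf.
exact: eq_condexp.
Qed.

Lemma Z1col_stable g w :
  w \in Z1col E phi nu -> gact_cochain1 g w \in Z1col E phi nu.
Proof.
move=> /Z1colP[wf wz wc]; apply/Z1colP; split.
- move=> L; have [w0 wN] := wf (gset g^-1%g L); split=> eta eta' /=.
    by rewrite -(transition_gconf g^-1%g) => /w0.
  exact: wN.
- move=> L N s sP sN.
  apply: (wz _ N (fun i => gconf g^-1%g (s i))) => [i iN|].
    by rewrite transition_gconf sP.
  by rewrite sN.
- move=> L L' h e eE eta.
  have eE' : edge_in E (gedge g^-1%g e) by rewrite gedge_in.
  have C (M : {fset X}) (c : M * M) (zeta : conf S M) :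
      component phi (act1 g w M) c zeta =
      component phi (w _) (gedge g^-1%g c) (gconf g^-1%g zeta).
    by rewrite /component /act1 move_gedge.
  rewrite [RHS]C -(wc _ _ (gsetS g^-1%g h)) // condexp_gconf.
  apply: eq_condexp => eta'; rewrite [LHS]C; congr (component _ _ _ _).
  by rewrite /edge_incl /gedge /=; congr (_, _); apply: val_inj.
Qed.

Definition gact_C0col : gaction G (subspace (C0col nu)) :=
  sub_gaction C0col_stable.

Definition gact_Z1col : gaction G (subspace (Z1col E phi nu)) :=
  sub_gaction Z1col_stable.

Lemma dcol_equivariant g f :
  dcol E phi nu (gact_C0col g f) = gact_Z1col g (dcol E phi nu f).
Proof.
apply: val_inj; apply: familyP => L; apply/funext => eta; apply/funext => eta'.
by rewrite /= /dfam /act1 /= transition_gconf.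
Qed.

Definition gact_H0col : gaction G (subspace (ker (dcol E phi nu))) :=
  ker_gaction dcol_equivariant.

Definition orbit_reps (I0 : set {fset X}) :=
  (forall L, I0 L -> L != fset0) /\
  (forall L, L != fset0 -> exists! L0, I0 L0 /\ exists g, L = gset g L0).

End ConfAction.

Arguments dcol_equivariant {X E G} act {S} phi {R} nu g f.

Notation Z1colG act phi nu := (subspace (ginvariant (gact_Z1col act phi nu))).
Notation H1H0col act phi nu := (H1 (gact_H0col act phi nu)).
Notation dC0colG act phi nu :=
  (image_invariant (gact_C0col act nu) (gact_Z1col act phi nu) (dcol _ phi nu)).

(* Main.v *)
(** The map [dcol] is surjective: a closed form on a finite [S^L] is exact, and
    the compatible choice of potentials is a linear system each of whose
    equations has finitely many unknowns, so it is solvable as soon as its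
    finite subsystems are.  Hence, by the long exact sequence, everything
    reduces to showing that a cocycle [rho] with values in C^0_col is
    [g |-> theta - g theta].  A co-local function is the same as a free family
    of local parts, indexed by the nonempty finite subsets of [X], on which [G]
    acts freely because it is torsion free and acts freely on [X]; so [theta]
    can be written down orbit by orbit, with any prescribed local parts, for
    instance zero, on a set [I0] of representatives.

    The cocycle of such a [theta] depends on the cocycle [rho] and not only on
    its class, so the splitting of [delta] also uses a linear choice of
    representatives. *)

Require Import Defs.
From HB Require Import structures.
From mathcomp Require Import all_boot all_order all_algebra.
From mathcomp Require Import finmap.
From mathcomp Require Import boolp classical_sets functions reals.
From mathcomp Require Import ring.

Local Open Scope ring_scope.

Set Implicit Arguments.
Unset Strict Implicit.
Unset Printing Implicit Defensive.

Import Order.TTheory GRing.Theory Num.Theory.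

Local Open Scope fset_scope.
Local Open Scope ring_scope.

(** * Linear algebra *)

Lemma linear_bundle (K : pzRingType) (U V : lmodType K) (f : U -> V) :
  linear f -> exists g : {linear U -> V}, g =1 f.
Proof.
move=> lf.
pose g : {linear U -> V} := HB.pack f (GRing.isLinear.Build K U V *:%R f lf).
by exists g.
Qed.

(** Zorn's lemma gives a maximal set closed under linear combinations and meeting [W] at most in 0;
    if it were not a complement, a line could be added to it. *)
Lemma complement_exists (K : fieldType) (V : lmodType K) (W : submodClosed V) :
  exists U : set V,
    [/\ forall a u v, U u -> U v -> U (a *: u + v),
        forall u, U u -> u \in W -> u = 0 &
        forall v, exists2 u, U u & v - u \in W].
Proof.
pose P (U : set V) := (forall a u v, U u -> U v -> U (a *: u + v)) /\
  (forall u, U u -> u \in W -> u = 0).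
have [F FP Ftot|U [[Ulin UW] Umax]] := @Zorn_bigcup V P.
  split=> [a u v [A FA Au] [B FB Bv]|u [A FA Au]]; last exact: (FP A FA).2.
  have [AB|BA] := Ftot A B FA FB.
    by exists B => //; apply: (FP B FB).1 => //; exact: AB.
  by exists A => //; apply: (FP A FA).1 => //; exact: BA.
(* The empty set satisfies [P], so [U 0] has to come from maximality. *)
have U0 : U 0.
  apply: contrapT => nU0; apply: (Umax (fun v => U v \/ v = 0)).
    by split=> [v Uv|sub]; [left | apply: nU0; apply: sub; right].
  split=> [a u v|u [/UW|//]//].
  move=> [Uu|->] [Uv|->]; rewrite ?scaler0 ?addr0 ?add0r; [left|left|left|right] => //.
    exact: Ulin.
  by have := Ulin (a - 1) _ _ Uu Uu; rewrite scalerBl scale1r subrK.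
exists U; split=> // v; apply: contrapT => nv.
apply: (Umax (fun x => exists a, U (x - a *: v))).
  split=> [x Ux|sub]; first by exists 0; rewrite scale0r subr0.
  apply: nv; exists v; last by rewrite subrr rpred0.
  by apply: sub; exists 1; rewrite scale1r subrr.
split=> [a x y [b Ub] [c Uc]|x [a Ua] xW].
  exists (a * b + c); have := Ulin a _ _ Ub Uc; congr (U _).
  by rewrite scalerBr scalerDl scalerA opprD addrACA.
have [a0|a0] := eqVneq a 0.
  by apply: UW => //; move: Ua; rewrite a0 scale0r subr0.
case: nv; exists (- a^-1 *: (x - a *: v) + 0); first exact: Ulin.
rewrite addr0 scalerBr scalerA mulNr mulVf // scaleN1r opprK scaleNr.
by rewrite opprD opprK addrCA subrr addr0 rpredZ.
Qed.

(** Preimages are chosen in a complement of the kernel, where they are unique; uniqueness makes the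
    choice linear. *)
Lemma linear_section (K : fieldType) (V W : lmodType K) (f : {linear V -> W}) :
  (forall w, exists v, f v = w) ->
  exists s : {linear W -> V}, forall w, f (s w) = w.
Proof.
move=> fsurj; have [U [Ulin UW Usurj]] := complement_exists (ker f).
have ex w : exists v, U v /\ f v = w.
  have [v <-] := fsurj w; have [u Uu /kerP vu] := Usurj v.
  by exists u; split=> //; apply/eqP; rewrite eq_sym -subr_eq0 -linearB vu.
have [s sP] := choice ex.
have [|s' sE] := @linear_bundle _ _ _ s; last first.
  by exists s' => w; rewrite sE; case: (sP w).
move=> a x y; have [Ux fx] := sP x; have [Uy fy] := sP y.
have [Uz fz] := sP (a *: x + y); apply/eqP; rewrite -subr_eq0; apply/eqP/UW.
  by have := Ulin (-1) _ _ (Ulin a _ _ Ux Uy) Uz; rewrite scaleN1r [- _ + _]addrC.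
by apply/kerP; rewrite linearB linearP fx fy fz subrr.
Qed.

Lemma linear_quotient (K : fieldType) (V U : lmodType K) (W : submodClosed V)
    (f : {linear V -> U}) : (forall v, v \in W -> f v = 0) ->
  exists g : {linear quotient W -> U}, forall v, g (qclass W v) = f v.
Proof.
move=> fW; have [s sP] := linear_section (@qclass_surj _ _ W).
exists (f \o s) => v /=; apply/eqP; rewrite -subr_eq0 -linearB; apply/eqP/fW.
by apply/qclassP; exact: sP.
Qed.

Section SurjectiveLinear.
Variables (K : fieldType) (V U : lmodType K) (W : submodClosed V).
Variable f : {linear V -> U}.
Hypothesis kerf : forall v, (f v == 0) = (v \in W).

Lemma linear_quotient_iso : (forall u, exists v, f v = u) ->
  exists2 psi : {linear quotient W -> U},
    bijective psi & forall v, psi (qclass W v) = f v.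
Proof.
move=> fsurj; have [v|psi psiE] := @linear_quotient _ _ _ W f.
  by rewrite -kerf => /eqP.
exists psi => //; have [s sP] := choice fsurj.
exists (fun u => qclass W (s u)) => [q|u]; last by rewrite psiE.
have [v <-] := qclass_surj q; rewrite psiE; apply/qclassP.
by rewrite -kerf linearB sP subrr.
Qed.

Lemma linear_decomposition (s : {linear U -> V}) : (forall u, f (s u) = u) ->
  exists2 dec : {linear (subspace W * U)%type -> V},
    bijective dec & forall w u, dec (w, u) = inc w + s u.
Proof.
move=> sP; have [|dec decE] := @linear_bundle _ (subspace W * U)%type V
    (fun p => inc p.1 + s p.2).
  move=> a x y; rewrite scalerDr addrACA.
  by congr (_ + _); exact: (linearP s).
exists dec; last by move=> w u; rewrite decE.
have im v : v - s (f v) \in W by rewrite -kerf linearB sP subrr.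
exists (fun v => (Subspace (im v), f v)) => [[w u]|v]; rewrite decE; last first.
  exact: subrK.
have fE : f (inc w + s u) = u.
  have fw : f (inc w) = 0 by apply/eqP; rewrite kerf; exact: valP.
  by rewrite linearD sP fw add0r.
by congr (_, _); [apply: val_inj; rewrite /= fE addrK | rewrite fE].
Qed.

End SurjectiveLinear.

(** * The connecting map *)

Section Connecting.
Variables (K : fieldType) (G : groupType) (U V : lmodType K).
Variables (A : gaction G U) (B : gaction G V) (d : {linear U -> V}).
Hypothesis dE : forall g u, d (A g u) = B g (d u).
Hypothesis d_surj : forall v, exists u, d u = v.

Let Hker := ker_gaction dE.

Lemma boundary_cocycle theta : d theta \in ginvariant B ->
  exists rho : subspace (cocycle Hker),
    forall g, inc (inc rho g) = theta - A g theta.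
Proof.
move=> /ginvariantP inv.
have kr g : theta - A g theta \in ker d.
  by apply/kerP; rewrite linearB dE inv subrr.
have rP : (fun g => Subspace (kr g)) \in cocycle Hker.
  apply/cocycleP => g h; apply: val_inj => /=.
  by rewrite gactM linearB addrA subrK.
by exists (Subspace rP).
Qed.

(** As [is_boundary] accepts any lift, a combination of lifts can be used as the lift of the
    combination. *)
Lemma is_boundary_linear (delta : subspace (ginvariant B) -> H1 Hker) :
  is_boundary dE delta -> linear delta.
Proof.
move=> dP a v w; have [[x xE] /(_ x xE)[r rE ->]] := dP v.
have [[y yE] /(_ y yE)[s sE ->]] := dP w.
have [_ /(_ (a *: x + y))[|t tE ->]] := dP (a *: v + w).
  by rewrite linearP xE yE.
suff -> : t = a *: r + s by rewrite linearP.
apply: val_inj; apply/funext => g; apply: val_inj; rewrite [LHS]tE linearP.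
transitivity (a *: inc (inc r g) + inc (inc s g)) => //.
by rewrite rE sE scalerBr opprD addrACA.
Qed.

Lemma boundary_exists :
  exists delta : {linear subspace (ginvariant B) -> H1 Hker},
    is_boundary dE delta.
Proof.
have ex (w : subspace (ginvariant B)) : exists c : H1 Hker,
    forall theta, d theta = inc w ->
    exists2 rho : subspace (cocycle Hker),
      forall g, inc (inc rho g) = theta - A g theta &
      c = qclass (coboundary Hker) rho.
  have [u uE] := d_surj (inc w).
  have [|r rE] := @boundary_cocycle u; first by rewrite uE; exact: valP.
  exists (qclass _ r) => t tE.
  have [|q qE] := @boundary_cocycle t; first by rewrite tE; exact: valP.
  exists q => //; apply/qclassP/coboundaryP.
  (* Two lifts differ by an element of [ker d], whose coboundary is the difference of their
     cocycles. *)
  have kut : u - t \in ker d by apply/kerP; rewrite linearB uE tE subrr.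
  exists (Subspace kut) => g; apply: val_inj.
  transitivity (inc (inc r g) - inc (inc q g)) => //.
  by rewrite rE qE [RHS]/= (linearB (A g)) !opprD !opprK addrACA.
have [delta deltaP] := choice ex.
have dP : is_boundary dE delta.
  by move=> w; split; [exact: d_surj | exact: deltaP].
have [delta' E] := linear_bundle (is_boundary_linear dP).
by exists delta'; have -> : (delta' : _ -> _) = delta by apply/funext.
Qed.

Variable delta : {linear subspace (ginvariant B) -> H1 Hker}.
Hypothesis deltaP : is_boundary dE delta.

(** If the cocycle of a lift [t] is the coboundary of [v] in [ker d], then [t - v] is an invariant
    lift. Conversely, an invariant lift [u] makes it the coboundary of [t - u]. *)
Lemma boundary_eq0 w : (delta w == 0) = (w \in image_invariant A B d).
Proof.
have [[t tE] /(_ t tE)[r rE dw]] := deltaP w.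
have d0 : delta w = 0 <-> r \in coboundary Hker.
  rewrite dw -(linear0 (qclass (coboundary Hker))).
  by split=> [/qclassP|rB]; [rewrite subr0 | apply/qclassP; rewrite subr0].
apply/eqP/idP => [/d0/coboundaryP[v vE]|/image_invariantP[u /ginvariantP uG du]].
  apply/image_invariantP; exists (t - inc v); last first.
    by rewrite linearB tE (kerP _ _ (valP v)) subr0.
  apply/ginvariantP => g; apply/eqP; rewrite eq_sym -subr_eq0 (linearB (A g)).
  have E : t - A g t = inc v - A g (inc v) by rewrite -rE vE.
  by rewrite opprD opprK addrACA E addrACA subrr addNr addr0.
apply: (d0.2 _); apply/coboundaryP.
have kut : t - u \in ker d by apply/kerP; rewrite linearB tE du subrr.
exists (Subspace kut) => g; apply: val_inj.
by rewrite [LHS]rE /= linearB uG opprB addrA subrK.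
Qed.

(* The splitting is a linear section of [delta] over those classes that are
   boundaries [d theta] with [theta] in [T]. *)
Lemma boundary_split (T : set U) :
  T 0 -> (forall a u v, T u -> T v -> T (a *: u + v)) ->
  (forall rho : subspace (cocycle Hker), exists2 theta, T theta &
     forall g, inc (inc rho g) = theta - A g theta) ->
  exists s : {linear H1 Hker -> subspace (ginvariant B)},
    (forall c, delta (s c) = c) /\
    (forall c, exists2 theta, d theta = inc (s c) & T theta).
Proof.
move=> T0 Tlin Tsurj.
pose P : {pred subspace (ginvariant B)} :=
  [pred w | `[< exists2 u, T u & d u = inc w >]].
have Pc : submod_closed P.
  split=> [|a v w /asboolP[x xT xE] /asboolP[y yT yE]]; apply/asboolP.
    by exists 0; [exact: T0 | exact: linear0].
  by exists (a *: x + y); [exact: Tlin | rewrite linearP xE yE].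
pose P' : submodClosed (subspace (ginvariant B)) := HB.pack P
  (GRing.isSubmodClosed.Build K _ P (GRing.submod_closed_semi Pc)).
have [|f fE] := @linear_bundle _ (subspace P') (H1 Hker) (fun w => delta (inc w)).
  by move=> a x y; rewrite -linearP.
have [c|s sP] := linear_section (f := f).
  have [r <-] := qclass_surj c; have [t tT tE] := Tsurj r.
  have inv : d t \in ginvariant B.
    apply/ginvariantP => g; rewrite -dE; apply/eqP; rewrite eq_sym -subr_eq0.
    by rewrite -linearB -tE (kerP _ _ (valP (inc r g))).
  have tP : Subspace inv \in P' by apply/asboolP; exists t.
  exists (Subspace tP); rewrite fE /=.
  have [_ /(_ t erefl)[r' rE ->]] := deltaP (Subspace inv).
  congr (qclass _ _); apply: val_inj; apply/funext => g; apply: val_inj.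
  by rewrite [LHS]rE [RHS]tE.
have [|s' sE] := @linear_bundle _ _ _ (fun c => inc (s c)).
  by move=> a x y; rewrite linearP.
exists s'; split=> c; rewrite sE; first by have := sP c; rewrite fE.
by have /asboolP[u] := valP (s c); exists u.
Qed.

End Connecting.

(** The algebraic half of the theorem: [D] selects the admissible choices [j], and [T j] the
    elements normalised by [j]. The substantial inputs are that [d] is onto and that cocycles are
    trivialised by normalised elements. *)
Lemma connecting_decomposition (K : fieldType) (G : groupType)
    (U V : lmodType K) (A : gaction G U) (B : gaction G V)
    (d : {linear U -> V}) (dE : forall g u, d (A g u) = B g (d u))
    (J : Type) (D : set J) (T : J -> set U) :
  (forall v, exists u, d u = v) -> (exists j, D j) ->
  (forall j, T j 0) ->
  (forall j a u v, T j u -> T j v -> T j (a *: u + v)) ->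
  (forall j, D j -> forall rho : subspace (cocycle (ker_gaction dE)),
     exists2 theta, T j theta & forall g, inc (inc rho g) = theta - A g theta) ->
  exists delta : {linear subspace (ginvariant B) -> H1 (ker_gaction dE)},
  [/\ is_boundary dE delta,
      exists2 psi : {linear quotient (image_invariant A B d) ->
                            H1 (ker_gaction dE)},
        bijective psi &
        forall w, psi (qclass (image_invariant A B d) w) = delta w &
      forall j, D j ->
      exists s : {linear H1 (ker_gaction dE) -> subspace (ginvariant B)},
      [/\ forall c, delta (s c) = c,
          forall c, exists2 theta, d theta = inc (s c) & T j theta &
          exists2 dec : {linear (subspace (image_invariant A B d) *
                                 H1 (ker_gaction dE))%type ->
                                subspace (ginvariant B)},
            bijective dec & forall b c, dec (b, c) = inc b + s c]].
Proof.
move=> d_surj [j0 Dj0] T0 Tlin Tsurj.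
have [delta deltaP] := boundary_exists dE d_surj.
have splitE j (Dj : D j) := boundary_split deltaP (T0 j) (Tlin j) (Tsurj j Dj).
have kerE := boundary_eq0 deltaP.
exists delta; split=> // [|j Dj].
  have [s [sK _]] := splitE j0 Dj0.
  have dsurj c : exists w, delta w = c by exists (s c).
  (* Unification of the module structures on [H1] is slow here, their
     conversion at [Qed] is not. *)
  exact_no_check (linear_quotient_iso kerE dsurj).
have [s [sK sT]] := splitE j Dj; exists s; split=> //.
exact_no_check (linear_decomposition kerE sK).
Qed.

(** * Solvability of infinite linear systems *)

(* Zorn's lemma is applied to the partial assignments all of whose finite parts
   are compatible with every [A t].  A value can always be added: either the
   solutions compatible with some finite part agree at [i], or, solution sets
   being affine, every value at [i] is allowed. *)
Lemma affine_compactness (K : fieldType) (I : eqType) (T : Type)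
    (A : T -> set (I -> K)) :
  (forall t, exists x, A t x) ->
  (forall t u, exists v, (A v `<=` A t `&` A u)%classic) ->
  (forall t a x y, A t x -> A t y -> A t (fun i => a * (y i - x i) + x i)) ->
  (forall t, exists s : seq I, forall x y,
     (forall i, i \in s -> x i = y i) -> A t x -> A t y) ->
  exists x, forall t, A t x.
Proof.
move=> Ane Adir Aaff Afin.
pose P (H : set (I * K)) := forall t (s : seq (I * K)),
  (forall p, p \in s -> H p) ->
  exists2 x, A t x & forall p, p \in s -> x p.1 = p.2.
have [F FP Ftot t s sF|H [HP Hmax]] := @Zorn_bigcup _ P.
  (* A finite list in the union of a chain lies in one member; the empty list is separate because
     the chain may be empty. *)
  have [s0|[C FC sC]] : s = [::] \/ exists2 C, F C & forall p, p \in s -> C p.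
    elim: s sF => [|p s IH] sF; first by left.
    right; have [C FC Cp] := sF p (mem_head p s).
    have [q qs|->|[D FD sD]] := IH; first by apply: sF; rewrite inE qs orbT.
      by exists C => // q; rewrite inE => /eqP ->.
    have [CD|DC] := Ftot C D FC FD.
      exists D => // q; rewrite inE => /orP[/eqP ->|]; [exact: CD | exact: sD].
    by exists C => // q; rewrite inE => /orP[/eqP -> //|/sD/DC].
  - by have [x Ax] := Ane t; exists x => // p; rewrite s0.
  - exact: (FP C FC).
have extend i c : P (fun p => H p \/ p = (i, c)) -> H (i, c).
  move=> PH; apply: contrapT => nH; refine (Hmax _ _ PH).
  by split=> [p|sub]; [left | apply: nH; apply: sub; right].
have Htot i : exists c, H (i, c).
  (* Either one [A t] and a finite part of [H] force the value at [i], or the value 0 can be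
     attained. *)
  have [[t [s [c [sH sc]]]]|free] := EM (exists t (s : seq (I * K)) c,
      (forall p, p \in s -> H p) /\ (forall x, A t x ->
        (forall p, p \in s -> x p.1 = p.2) -> x i = c)).
    exists c; apply: extend => t' s' s'H; have [v vtt'] := Adir t t'.
    have [p|x Ax xs] := HP v (s ++ [seq p <- s' | p != (i, c)]).
      rewrite mem_cat mem_filter => /orP[/sH //|/andP[/eqP pc /s'H[]//]].
    have [At At'] := vtt' x Ax; exists x => // p ps'.
    have [->/=|pc] := eqVneq p (i, c).
      by apply: sc => // q qs; apply: xs; rewrite mem_cat qs.
    by apply: xs; rewrite mem_cat mem_filter pc ps' orbT.
  exists 0; apply: extend => t s sH; pose s' := [seq p <- s | p != (i, 0)].
  have s'H p : p \in s' -> H p.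
    by rewrite mem_filter => /andP[/eqP pc /sH[]].
  have [x Ax xs] := HP t s' s'H.
  have [y [Ay ys yx]] : exists y,
      [/\ A t y, forall p, p \in s' -> y p.1 = p.2 & y i != x i].
    apply: contrapT => none; apply: free; exists t, s', (x i); split=> // y Ay ys.
    by apply/eqP; apply: contrapT => /negP yx; apply: none; exists y.
  (* The point with value 0 at [i] on the line through [x] and [y]; on [s'] all its points agree
     with [H]. *)
  exists (fun j => - x i / (y i - x i) * (y j - x j) + x j); first exact: Aaff.
  move=> p ps; have [->/=|pc] := eqVneq p (i, 0).
    by rewrite divfK ?subr_eq0 // addNr.
  have ps' : p \in s' by rewrite mem_filter pc.
  by rewrite xs // ys // subrr mulr0 add0r.
have [x xH] := choice Htot; exists x => t; have [s sA] := Afin t.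
have [p /mapP[i _ ->] //|y Ay ys] := HP t [seq (i, x i) | i <- s].
by apply: sA Ay => i si; apply: (ys (i, x i)); apply: map_f.
Qed.

(** * Conditional expectations *)

Section Expectation.
Variables (R : realFieldType) (X : choiceType) (S : finType).
Variable nu : full_prob R S.
Implicit Types L : {fset X}.

Lemma pr_pr M L N (h : M `<=` L) (h' : L `<=` N) (h'' : M `<=` N)
    (eta : conf S N) : pr h (pr h' eta) = pr h'' eta.
Proof. by apply/ffunP => x; rewrite !ffunE; congr (eta _); apply: val_inj. Qed.

Lemma sum_mu L : \sum_(eta : conf S L) mu nu eta = 1.
Proof.
rewrite /mu -(bigA_distr_bigA (fun _ => nu)) big1 // => x _.
exact: pmass_sum1.
Qed.

Lemma expect_condexp L L' (h : L `<=` L') f :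
  expect nu (condexp nu h f) = expect nu f.
Proof.
rewrite /expect [RHS](partition_big (pr h) predT) //=.
apply: eq_bigr => eta _; rewrite mulrAC mulVf ?mul1r //.
by rewrite gt_eqF ?mu_gt0.
Qed.

Lemma condexp_condexp M L N (h : M `<=` L) (h' : L `<=` N) (h'' : M `<=` N) f :
  condexp nu h (condexp nu h' f) =1 condexp nu h'' f.
Proof.
move=> eta; congr (_ * _).
rewrite [RHS](partition_big (pr h') (fun zeta => pr h zeta == eta)) /=.
  apply: eq_bigr => zeta /eqP <-; rewrite mulrAC mulVf ?gt_eqF ?mu_gt0 // mul1r.
  apply: eq_bigl => xi; have [<-|] := eqVneq (pr h' xi) zeta; last by rewrite andbF.
  by rewrite (pr_pr _ _ h'') eqxx.
by move=> xi; rewrite (pr_pr _ _ h'').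
Qed.

End Expectation.

(** * Closed forms are exact *)

(** A move that changes [eta] changes the pair of states on its edge, so the interaction axiom lets
    the reversed edge undo it. *)
Lemma transition_symmetric (X : choiceType) (E : locale X) (S : finType)
    (phi : interaction S) (L : {fset X}) :
  symmetric (@transition X E S phi L).
Proof.
suff H (eta eta' : conf S L) :
    transition E phi eta eta' -> transition E phi eta' eta.
  by move=> eta eta'; apply/idP/idP; exact: H.
case/existsP=> e /and3P[eE ne /eqP ->]; apply/existsP; exists (swap e).
have n21 : e.2 == e.1 = false by rewrite eq_sym; exact/negbTE/(edge_in_neq eE).
have fixedE : phi (eta e.1, eta e.2) <> (eta e.1, eta e.2).
  move=> fixed; case/eqP: ne; apply/ffunP => z; rewrite ffunE fixed /=.
  by case: eqP => [->//|_]; case: eqP => [->|].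
have back : emove phi (swap e) (emove phi e eta) = eta.
  apply/ffunP => z; rewrite !ffunE /= !eqxx n21 -[(_.2, _.1)]/(swap _).
  have /= := imapK fixedE; rewrite /swap => -[E2 E1]; rewrite E1 E2.
  by case: eqP => [->//|_]; case: eqP => [->|].
by rewrite back eqxx eq_sym ne /edge_in /= edge_sym -/(edge_in E e) eE.
Qed.

Section Exactness.
Variables (T : finType) (e : rel T) (V : zmodType) (w : T -> T -> V).

Fixpoint path_sum x p :=
  if p is y :: q then w x y + path_sum y q else 0.

Lemma path_sum_cat x p q :
  path_sum x (p ++ q) = path_sum x p + path_sum (last x p) q.
Proof. by elim: p x => [|y p IH] x /=; rewrite ?add0r // IH addrA. Qed.

Lemma path_sumE x p : path_sum x p =
  \sum_(i < size p) w (nth x (x :: p) i) (nth x (x :: p) i.+1).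
Proof.
elim: p x => [|y p IH] x; first by rewrite big_ord0.
rewrite big_ord_recl [LHS]/= IH; congr (_ + _); apply: eq_bigr => i _ /=.
by congr (w _ _); apply: set_nth_default => //=; rewrite ltnW // ltnS ltn_ord.
Qed.

(** The potential at [x] is minus the sum along a chosen path from [x] to the root of its component.
    The closed paths root, [x], root and root, [x], [y], root determine its increment across an
    edge. *)
Lemma potential_exists : symmetric e ->
  (forall x p, path e x p -> last x p = x -> path_sum x p = 0) ->
  exists f, forall x y, e x y -> w x y = f y - f x.
Proof.
move=> e_sym w0; have csym := sym_connect_sym e_sym.
have ex x : exists p, path e x p /\ fingraph.root e x = last x p.
  by have /connectP[p] := connect_root e x; exists p.
have [p pP] := choice ex; exists (fun x => - path_sum x (p x)) => x y xy.
have [[px lx] [py ly]] := (pP x, pP y).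
have rxy : fingraph.root e x = fingraph.root e y by apply/eqP; rewrite root_connect // connect1.
have /connectP[q qP lq] : connect e (fingraph.root e x) x by rewrite csym connect_root.
have X0 := w0 (fingraph.root e x) (q ++ p x); rewrite cat_path qP -lq px last_cat -lq -lx in X0.
have Y0 := w0 (fingraph.root e x) (q ++ y :: p y).
rewrite cat_path qP -lq /= xy py last_cat -lq /= -ly -rxy in Y0.
have := Y0 isT erefl; rewrite -(X0 isT erefl) !path_sum_cat -lq /= => /addrI <-.
by rewrite opprK addrC addrK.
Qed.

End Exactness.

(** * Surjectivity of the differential on co-local functions *)

Section ExactForms.
Variables (R : realFieldType) (X : choiceType) (E : locale X).
Variables (S : finType) (phi : interaction S) (nu : full_prob R S).
Implicit Types L : {fset X}.

Lemma closed_exact L (w : conf S L -> conf S L -> R) :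
  is_closed E phi w -> exists f : conf S L -> R,
    forall eta eta', transition E phi eta eta' -> w eta eta' = f eta' - f eta.
Proof.
move=> wc; apply: potential_exists; first exact: transition_symmetric.
move=> eta p pP lp; rewrite path_sumE.
apply: (wc (size p) (fun i => nth eta (eta :: p) i)) => [i ip|].
  by move/(pathP eta): pP => /(_ i ip).
by rewrite -[RHS]lp (last_nth eta).
Qed.

(** The unknowns are the values of a potential at every configuration on every finite set. [A L]
    collects the equations on subsets of [L], and [affine_compactness] solves all of them at
    once. *)
Lemma dcol_surjective (w : subspace (Z1col E phi nu)) :
  exists f, dcol E phi nu f = w.
Proof.
have /Z1colP[wform wclosed wc] := valP w.
pose ix M (eta : conf S M) : {M : {fset X} & conf S M} := Tagged _ eta.
pose at_ (x : {M : {fset X} & conf S M} -> R) M := fun eta => x (ix M eta).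
pose A L (x : {M : {fset X} & conf S M} -> R) := [/\
  forall M N (h : M `<=` N), N `<=` L -> condexp nu h (at_ x N) =1 at_ x M,
  forall M, M `<=` L -> expect nu (at_ x M) = 0 &
  forall M, M `<=` L -> forall eta eta', transition E phi eta eta' ->
    inc w M eta eta' = at_ x M eta' - at_ x M eta].
have [L|L M|L a x y [xc x0 xd] [yc y0 yd]|L|x xA] :=
    @affine_compactness R {M : {fset X} & conf S M} {fset X} A.
(* [A L] is solved by a potential on [S^L], shifted to mean zero, and its conditional expectations;
   the value 0 outside subsets of [L] is a mere default. *)
- have [f fE] := closed_exact (wclosed L).
  pose f0 eta := - expect nu f * 1 + f eta.
  have Ef0 : expect nu f0 = 0.
    rewrite expectP [expect nu (fun=> 1)](_ : _ = 1) ?mulr1 ?addNr //.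
    by rewrite -[RHS](sum_mu nu L); apply: eq_bigr => eta _; rewrite mul1r.
  pose x (p : {M : {fset X} & conf S M}) : R :=
    if tag p `<=` L =P true is ReflectT h then condexp nu h f0 (tagged p) else 0.
  have xE M (h : M `<=` L) : at_ x M =1 condexp nu h f0.
    move=> eta; rewrite /at_ /x /=; case: eqP => // h'.
    by rewrite (bool_irrelevance h h').
  exists x; split=> [M N h hN eta|M hM|M hM eta eta'].
  + have hM := fsubset_trans h hN.
    by rewrite (xE M hM) (eq_condexp _ _ _ (xE N hN)) (condexp_condexp _ _ _ hM).
  + rewrite -Ef0 -(expect_condexp nu hM); apply: eq_bigr => eta _.
    by rewrite xE.
  + case/existsP=> e /and3P[eE _ /eqP ->].
    rewrite -/(component phi (inc w M) e eta) -(wc _ _ hM e eE) !(xE M hM).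
    rewrite condexp_move -condexpB; apply: eq_condexp => zeta.
    rewrite /component opprD addrACA subrr add0r.
    have [->|ne] := eqVneq (emove phi (edge_incl hM e) zeta) zeta.
      rewrite subrr; apply: (wform L).1; apply/existsPn => e'.
      by rewrite [zeta == _]eq_sym; case: eqP => _; rewrite /= ?andbF.
    apply: fE; apply/existsP; exists (edge_incl hM e).
    by apply/and3P; split.
- exists (L `|` M) => x [xc x0 xd]; split; split.
  + by move=> K N h hN; apply: xc; apply: fsubset_trans hN (fsubsetUl _ _).
  + by move=> K hK; apply: x0; apply: fsubset_trans hK (fsubsetUl _ _).
  + by move=> K hK; apply: xd; apply: fsubset_trans hK (fsubsetUl _ _).
  + by move=> K N h hN; apply: xc; apply: fsubset_trans hN (fsubsetUr _ _).
  + by move=> K hK; apply: x0; apply: fsubset_trans hK (fsubsetUr _ _).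
  + by move=> K hK; apply: xd; apply: fsubset_trans hK (fsubsetUr _ _).
- split=> [M N h hN eta|M hM|M hM eta eta' t].
  + by rewrite condexpP condexpB (xc _ _ h) // (yc _ _ h).
  + have Eyx : expect nu (fun eta => at_ y M eta - at_ x M eta) = 0.
      rewrite -[RHS](subrr 0) -{1}(y0 M hM) -(x0 M hM) /expect -sumrB.
      by apply: eq_bigr => eta _; rewrite mulrBl.
    transitivity (a * expect nu (fun eta => at_ y M eta - at_ x M eta) +
      expect nu (at_ x M)); first exact: expectP.
    by rewrite Eyx x0 // mulr0 addr0.
  + transitivity (a * (at_ y M eta' - at_ y M eta - (at_ x M eta' - at_ x M eta)) +
      (at_ x M eta' - at_ x M eta)).
      by rewrite -(yd M hM) // -(xd M hM) // subrr mulr0 add0r.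
    by rewrite /at_; ring.
- exists [seq ix M eta | M <- fpowerset L, eta <- enum {: conf S M}].
  move=> x y xy; have {xy}xyE M (hM : M `<=` L) : at_ x M = at_ y M.
    apply/funext => eta; apply: xy; apply: allpairs_f_dep.
      by rewrite fpowersetE.
    by rewrite mem_enum.
  move=> [xc x0 xd]; split=> [M N h hN|M hM|M hM].
  + by rewrite -!xyE // ?(fsubset_trans h hN) //; exact: xc.
  + by rewrite -xyE //; exact: x0.
  + by rewrite -xyE //; exact: xd.
have xC : (fun L => at_ x L) \in C0col nu.
  apply/C0colP; split=> [L|L L' h]; have [xc x0 _] := xA L.
    exact: x0.
  by have [xc' _ _] := xA L'; apply: xc'.
exists (Subspace xC); apply: val_inj; apply: functional_extensionality_dep => L.
apply/funext => eta; apply/funext => eta'; rewrite /= /dfam.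
have [_ _ xd] := xA L; case: ifPn => [t|nt]; first by rewrite [RHS]xd.
by rewrite (wform L).1.
Qed.

End ExactForms.

(** * Local parts of a co-local function *)

Section Restriction.
Variables (X : choiceType) (S : finType).
Implicit Types (L M K : {fset X}) (xi : X -> S).

(** Writing configurations as restrictions of functions on all of [X] avoids transport between the
    types [conf S L]: projections keep the same [xi]. *)
Definition restr L xi : conf S L := [ffun x => xi (val x)].

Lemma restrP L xi xi' : restr L xi = restr L xi' <-> {in L, xi =1 xi'}.
Proof.
split=> [/ffunP E x xL|E]; first by have := E [` xL]; rewrite !ffunE.
by apply/ffunP => x; rewrite !ffunE; apply: E; exact: valP.
Qed.

Lemma pr_restr L L' (h : L `<=` L') xi : pr h (restr L' xi) = restr L xi.
Proof. by apply/ffunP => x; rewrite !ffunE. Qed.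

Lemma restr_surj (s0 : S) L (eta : conf S L) : exists xi, restr L xi = eta.
Proof.
exists (fun x => if insub x is Some y then eta y else s0).
by apply/ffunP => x; rewrite ffunE valK.
Qed.

Lemma gconf_restr (E : locale X) (G : groupType) (act : locale_action G E) g L xi :
  gconf act g (restr L xi) = restr (gset act g L) (fun x => xi (act g^-1%g x)).
Proof. by apply/ffunP => x; rewrite !ffunE. Qed.

End Restriction.

(** * Sums over the subsets of a finite set *)

Section FinitePowersets.
Variables (X : choiceType) (R : realFieldType).
Implicit Types (L M K N : {fset X}) (F : {fset X} -> R).

Lemma sum_fpowersetS M L F : M `<=` L ->
  \sum_(K : fpowerset L | val K `<=` M) F (val K) = \sum_(K : fpowerset M) F (val K).
Proof.
move=> ML; rewrite -(big_seq_fsetE _ _ (fun K => K `<=` M)) big_fset_condE.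
rewrite -(big_seq_fsetE _ _ predT); congr (\big[_/_]_(K <- enum_fset _) _).
apply/fsetP => K; rewrite !inE !fpowersetE /=.
by case KM: (K `<=` M); rewrite ?andbF // (fsubset_trans KM ML).
Qed.

(* Toggling [x] is a sign-reversing involution. *)
Lemma alternating_sum_eq0 N x F : x \in N ->
  (forall K, F (x |` K) = F (K `\ x)) ->
  \sum_(K : fpowerset N) (-1) ^+ #|` N `\` val K| * F (val K) = 0.
Proof.
move=> xN FK; pose t K := if x \in K then K `\ x else x |` K.
have tK : involutive t.
  rewrite /t => K; case: (boolP (x \in K)) => xK.
    by rewrite !inE eqxx /= fsetD1K.
  by rewrite !inE eqxx /= fsetU1K.
have tN (K : fpowerset N) : t (val K) \in fpowerset N.
  have KN := fpowerset_sub K; rewrite fpowersetE /t; case: ifP => _.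
    exact: fsubset_trans (fsubD1set _ _) KN.
  by rewrite fsubUset fsub1set xN.
pose tau (K : fpowerset N) : fpowerset N := [` tN K].
have tauK : involutive tau by move=> K; apply: val_inj; rewrite /= tK.
have cardU K : x \notin K -> #|` N `\` K| = (#|` N `\` (x |` K)|).+1.
  by move=> xK; rewrite (cardfsD1 x) !inE xN xK fsetDDl fsetUC.
set s := LHS; suff : s = - s by move/eqP; rewrite -addr_eq0 -mulr2n mulrn_eq0 /= => /eqP.
rewrite {1}/s (reindex_inj (inv_inj tauK)) /= -sumrN; apply: eq_bigr => K _.
rewrite /t; case: ifPn => xK.
  have xK' : x \notin val K `\ x by rewrite !inE eqxx.
  rewrite (cardU _ xK') fsetD1K // exprS mulN1r mulNr.
  by rewrite -FK mem_fset1U.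
rewrite (cardU _ xK) exprS mulN1r mulNr opprK FK.
by rewrite mem_fsetD1.
Qed.

End FinitePowersets.

(** The inverse transform of [local_part], under Moebius inversion on finite subsets. *)
Definition sum_parts (R : realFieldType) (X : choiceType) (S : finType)
    (u : cochain0 R X S) : cochain0 R X S :=
  fun L eta => \sum_(K : fpowerset L) u (val K) (pr (fpowerset_sub K) eta).

Arguments sum_parts {R X S} u _ _.

Section LocalParts.
Variables (R : realFieldType) (X : choiceType) (S : finType) (s0 : S).
Variable nu : full_prob R S.
Implicit Types (L M K N : {fset X}) (xi : X -> S) (f u : cochain0 R X S).

Lemma mu_restr L xi : mu nu (restr L xi) = \prod_(x <- L) nu (xi x).
Proof.
by rewrite big_seq_fsetE /= /mu; apply: eq_bigr => x _; rewrite ffunE.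
Qed.

Lemma mu_restrUI M K xi :
  mu nu (restr (M `|` K) xi) * mu nu (restr (M `&` K) xi) =
  mu nu (restr M xi) * mu nu (restr K xi).
Proof.
rewrite !mu_restr (big_fsetID _ (mem M) (M `|` K)) (big_fsetID _ (mem M) K) /=.
rewrite -mulrA; congr (\big[_/_]_(x <- enum_fset _) _ * _).
  by apply/fsetP => x; rewrite !inE /=; case: (x \in M); rewrite ?andbF ?andbT.
rewrite mulrC; congr (_ * _); congr (\big[_/_]_(x <- enum_fset _) _);
  apply/fsetP => x; rewrite !inE /=; first exact: andbC.
by case: (x \in M); rewrite ?andbF ?andbT.
Qed.

(** The sum factors over the sites of [L]: those in [K] are pinned by [kappa], each other one
    contributes total mass 1. *)
Lemma sum_mu_pr K L (h : K `<=` L) (kappa : conf S K) :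
  \sum_(zeta | pr h zeta == kappa) mu nu zeta = mu nu kappa.
Proof.
have [xi <-] := restr_surj s0 kappa.
pose Q (x : L) := [pred s : S | (val x \in K) ==> (s == xi (val x))].
have QE zeta : (pr h zeta == restr K xi) = (zeta \in family Q).
  apply/eqP/familyP => [E x|E].
    rewrite inE; apply/implyP => xK; have /ffunP/(_ [` xK]) := E.
    by rewrite !ffunE /= => <-; apply/eqP; congr (zeta _); apply: val_inj.
  apply/ffunP => x; rewrite !ffunE; have := E (fincl h x).
  by rewrite inE /= (valP x) => /eqP.
under eq_bigl => zeta do rewrite QE.
rewrite /mu -(bigA_distr_big_dep Q (fun _ => nu)).
rewrite -/(mu nu (restr K xi)) mu_restr.
transitivity (\prod_(x : L | val x \in K) nu (xi (val x))).
  rewrite [RHS]big_mkcond; apply: eq_bigr => x _ /=; case: ifP => xK.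
    by rewrite (big_pred1 (xi (val x))).
  by rewrite pmass_sum1.
rewrite -(big_seq_fsetE _ _ (mem K) (fun x => nu (xi x))) big_fset_condE.
congr (\big[_/_]_(x <- enum_fset _) _); apply/fsetP => x; rewrite !inE /=.
by case xK: (x \in K); rewrite ?andbF // (fsubsetP h).
Qed.

(* Coordinates outside [M] are independent of those inside [M], so conditioning
   a function of the coordinates in [K] on [M] is conditioning on [M `&` K]. *)
Lemma condexp_pullback M K L (hM : M `<=` L) (hK : K `<=` L)
    (h : M `&` K `<=` K) (g : conf S K -> R) xi :
  condexp nu hM (fun zeta => g (pr hK zeta)) (restr M xi) =
  condexp nu h g (restr (M `&` K) xi).
Proof.
have hU : M `|` K `<=` L by rewrite fsubUset hM hK.
rewrite /condexp.
rewrite (partition_big (pr hK) (fun k => pr h k == restr (M `&` K) xi)) /=; last first.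
  move=> zeta; have [z <-] := restr_surj s0 zeta; rewrite !pr_restr.
  move=> /eqP/restrP E; apply/eqP/restrP => x; rewrite inE => /andP[xM _].
  exact: E.
rewrite !big_distrr; apply: eq_bigr => k /eqP kE.
(* [k] and [xi] agree on the intersection of [M] and [K], so they glue. *)
have [xi' [E1 E2]] : exists xi', restr K xi' = k /\ restr M xi' = restr M xi.
  have [z zE] := restr_surj s0 k; exists (fun x => if x \in K then z x else xi x).
  split; first by rewrite -zE; apply/restrP => x ->.
  apply/restrP => x xM; case: ifP => // xK; move: kE.
  by rewrite -zE pr_restr => /restrP; apply; rewrite inE xM.
have E3 : restr (M `&` K) xi' = restr (M `&` K) xi.
  by apply/restrP => x; rewrite inE => /andP[xM _]; move/restrP: E2; apply.
(* Restricting to [xi] on [M] and to [k] on [K] means restricting to [xi'] on the union. *)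
transitivity ((mu nu (restr M xi))^-1 *
    (g k * \sum_(z | pr hU z == restr (M `|` K) xi') mu nu z)).
  congr (_ * _); rewrite big_distrr; apply: eq_big => [zeta|zeta /andP[_ /eqP -> //]].
  have [z <-] := restr_surj s0 zeta; rewrite !pr_restr -E1 -E2.
  apply/andP/eqP => [[/eqP/restrP EM /eqP/restrP EK]|/restrP EU].
    by apply/restrP => x; rewrite inE => /orP[/EM|/EK].
  by split; apply/eqP/restrP => x xI; apply: EU; rewrite inE xI ?orbT.
rewrite sum_mu_pr; have := mu_restrUI M K xi'; rewrite E1 E2 E3.
have nz L' xi1 : mu nu (restr L' xi1) != 0 by rewrite gt_eqF ?mu_gt0.
by move/(canRL (mulfK (nz _ _))) => -> /=; field; rewrite !nz.
Qed.

Lemma condexp_eq M K (h : M `<=` K) (g : conf S K -> R) xi :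
  M = K -> condexp nu h g (restr M xi) = g (restr K xi).
Proof.
move=> MK; case: K / MK h g => h g; rewrite /condexp (big_pred1 (restr M xi)).
  by rewrite mulrCA mulVf ?mulr1 // gt_eqF ?mu_gt0.
move=> zeta; congr (_ == _); apply/ffunP => x.
by rewrite ffunE; congr (zeta _); apply: val_inj.
Qed.

Lemma condexp_sum M K (h : M `<=` K) (I : finType) (c : I -> R)
    (g : I -> conf S K -> R) eta :
  condexp nu h (fun zeta => \sum_i c i * g i zeta) eta =
  \sum_i c i * condexp nu h (g i) eta.
Proof.
rewrite /condexp; under eq_bigr do rewrite big_distrl.
rewrite exchange_big big_distrr; apply: eq_bigr => i _ /=.
rewrite mulrCA; congr (_ * _); rewrite big_distrr /=.
by apply: eq_bigr => z _; rewrite mulrA.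
Qed.

Lemma local_part_restr f L xi : local_part f L (restr L xi) =
  \sum_(K : fpowerset L) (-1) ^+ #|` L `\` val K| * f (val K) (restr (val K) xi).
Proof. by apply: eq_bigr => K _; rewrite pr_restr. Qed.

Lemma local_partP a f g L eta :
  local_part (a *: f + g) L eta = a * local_part f L eta + local_part g L eta.
Proof.
rewrite /local_part big_distrr -big_split; apply: eq_bigr => K _ /=.
by rewrite mulrCA -mulrDr.
Qed.

Lemma local_partB f g L eta :
  local_part (f - g) L eta = local_part f L eta - local_part g L eta.
Proof. by rewrite addrC -scaleN1r local_partP mulN1r addrC. Qed.

Lemma local_part_fset0 f eta : local_part f fset0 eta = f fset0 eta.
Proof.
have [xi <-] := restr_surj s0 eta; rewrite local_part_restr.
have m : fset0 \in fpowerset (@fset0 X) by rewrite fpowersetE.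
rewrite (big_pred1 [` m]) /= ?fsetDv ?cardfs0 ?mul1r // => K.
by apply/esym/eqP; apply: val_inj; apply/eqP; rewrite -fsubset0 fpowerset_sub.
Qed.

(** Induction on cardinality: [f L] enters its own local part with coefficient 1, and the other
    terms belong to proper subsets. *)
Lemma local_part_eq0 f :
  (forall L eta, local_part f L eta = 0) -> forall L eta, f L eta = 0.
Proof.
move=> f0 L eta; have [xi <-] := restr_surj s0 eta.
elim: {L eta}_.+1 {-2}L (ltnSn #|` L|) => // n IH L Ln.
have := f0 L (restr L xi); rewrite local_part_restr.
have m : L \in fpowerset L by rewrite fpowersetE.
rewrite (bigD1 [` m]) //= fsetDv cardfs0 mul1r big1 ?addr0 // => K KL.
rewrite IH ?mulr0 //; apply: (leq_trans _ (Ln : (#|` L| <= n)%N)); apply: fproper_ltn_card.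
rewrite fproperEneq fpowerset_sub andbT; apply: contraNneq KL => KL.
by apply/eqP; apply: val_inj.
Qed.

Lemma colocal_fset0 f eta : f \in C0col nu -> f fset0 eta = 0.
Proof.
move=> /C0colP[f0 _]; rewrite -[RHS](f0 fset0) /expect (big_pred1 eta).
  by rewrite /mu big1 ?mulr1 // => -[].
by move=> zeta; apply/esym/eqP/ffunP => -[].
Qed.

(** Together with vanishing on the empty set, this characterises the families of local parts of
    co-local functions. *)
Definition pure u := forall M N (h : M `<=` N), M != N ->
  forall eta, condexp nu h (u N) eta = 0.

(** For [x] in [N] outside [M], conditioning on [M] turns the term of [K] into one that ignores
    whether [x] is in [K], so the alternating sum cancels. *)
Lemma local_part_pure f : f \in C0col nu -> pure (local_part f).
Proof.
move=> /C0colP[_ fc] M N h MN eta; have [xi <-] := restr_surj s0 eta.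
have [x xN xM] : exists2 x, x \in N & x \notin M.
  by apply/fsubsetPn; apply: contra MN => NM; rewrite eqEfsubset h.
rewrite condexp_sum.
under eq_bigr => K _ do rewrite (condexp_pullback _ _ (fsubsetIr _ _)) fc.
apply: (@alternating_sum_eq0 _ _ N x (fun K => f (M `&` K) (restr (M `&` K) xi))) => // K.
have -> // : M `&` (x |` K) = M `&` (K `\ x).
apply/fsetP => y; rewrite !inE; case: eqP => [->|_] //=.
by rewrite (negbTE xM).
Qed.

Lemma sum_parts_restr u L xi : sum_parts u L (restr L xi) =
  \sum_(K : fpowerset L) u (val K) (restr (val K) xi).
Proof. by apply: eq_bigr => K _; rewrite pr_restr. Qed.

(** Conditioning on [L] keeps the parts of subsets of [L] and kills the others by purity.
    Conditioning on the empty set computes the mean and leaves only [u fset0]. *)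
Lemma sum_parts_colocal u :
  (forall eta, u fset0 eta = 0) -> pure u -> sum_parts u \in C0col nu.
Proof.
move=> u0 upure.
have uc L L' (h : L `<=` L') : condexp nu h (sum_parts u L') =1 sum_parts u L.
  move=> eta; have [xi <-] := restr_surj s0 eta; rewrite sum_parts_restr.
  rewrite -(sum_fpowersetS (fun K => u K (restr K xi)) h) [RHS]big_mkcond.
  transitivity (condexp nu h (fun zeta => \sum_(K : fpowerset L')
      1 * u (val K) (pr (fpowerset_sub K) zeta)) (restr L xi)).
    by apply: eq_condexp => zeta; apply: eq_bigr => K _; rewrite mul1r.
  rewrite condexp_sum; apply: eq_bigr => K _; rewrite mul1r.
  rewrite (condexp_pullback _ _ (fsubsetIr _ _)); case: ifP => KL.
    by apply: condexp_eq; apply/fsetIidPr.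
  by apply: upure; apply: contraFneq KL => KL; rewrite -KL fsubsetIl.
apply/C0colP; split=> // L.
rewrite -(expect_condexp nu (fsub0set L)) /expect big1 // => eta _.
rewrite uc [sum_parts _ _ _]big1 ?mul0r // => K _.
have K0 : val K = fset0 by apply/eqP; rewrite -fsubset0 fpowerset_sub.
by move: (pr _ _); rewrite K0.
Qed.

(** After exchanging sums, the part at [J] has as coefficient an alternating sum over the sets
    between [J] and [L]: 1 if [J = L], else 0 by toggling a point of [L] outside [J]. *)
Lemma local_part_sum_parts u L eta : local_part (sum_parts u) L eta = u L eta.
Proof.
have [xi <-] := restr_surj s0 eta; rewrite local_part_restr.
pose U K := u K (restr K xi).
transitivity (\sum_(J : fpowerset L) U (val J) * \sum_(K : fpowerset L)
    (-1) ^+ #|` L `\` val K| * (val J `<=` val K)%:R).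
  under [RHS]eq_bigr do rewrite big_distrr.
  rewrite exchange_big; apply: eq_bigr => K _ /=; rewrite sum_parts_restr.
  rewrite -(sum_fpowersetS U (fpowerset_sub K)) big_mkcond big_distrr.
  by apply: eq_bigr => J _ /=; case: ifP => _; rewrite ?mulr0 // !mulr1 mulrC.
have m : L \in fpowerset L by rewrite fpowersetE.
have mE (K : fpowerset L) : (L `<=` val K) = (K == [` m]).
  by rewrite -val_eqE /= eqEfsubset fpowerset_sub.
rewrite (bigD1 [` m]) //= [X in _ + X]big1 ?addr0 => [|J JL].
  rewrite (bigD1 [` m]) //= fsetDv cardfs0 fsubset_refl big1 ?addr0 => [|K KL].
    by rewrite !mulr1.
  by rewrite mE (negbTE KL) mulr0.
have [x xL xJ] : exists2 x, x \in L & x \notin val J.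
  by apply/fsubsetPn; rewrite mE.
rewrite (@alternating_sum_eq0 _ _ L x (fun K => (val J `<=` K)%:R)) ?mulr0 // => K.
congr (_%:R); rewrite fsubsetD1 xJ andbT; congr nat_of_bool.
apply/fsubsetP/fsubsetP => JK y yJ; last by rewrite inE JK ?orbT.
have := JK y yJ; rewrite !inE => /orP[/eqP yx|//].
by rewrite -yx yJ in xJ.
Qed.

End LocalParts.

(** * The group action on finite subsets and on local parts *)

Section Equivariance.
Variables (R : realFieldType) (X : choiceType) (S : finType).
Variables (E : locale X) (G : groupType) (act : locale_action G E).

Lemma gset_inj g : injective (gset act g).
Proof.
by move=> L L' E0; rewrite -[L](gset1 act) -[L'](gset1 act) -(mulVg g) !gsetM E0.
Qed.

Lemma gset0 g : gset act g fset0 = fset0.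
Proof. by apply/fsetP => x; rewrite mem_gset !inE. Qed.

(** Translation by [g^-1] carries the subsets of [L] to those of its translate and preserves the
    signs. *)
Lemma local_part_act0 g (f : cochain0 R X S) L xi :
  local_part (act0 act g f) L (restr L xi) =
  local_part f (gset act g^-1%g L)
    (restr (gset act g^-1%g L) (fun x => xi (act g x))).
Proof.
rewrite !local_part_restr.
pose F K := f K (restr K (fun x => xi (act g x))).
rewrite -[RHS](big_seq_fsetE _ _ predT
  (fun K => (-1) ^+ #|` gset act g^-1%g L `\` K| * F K)).
have -> : fpowerset (gset act g^-1%g L) = [fset gset act g^-1%g K | K in fpowerset L].
  apply/fsetP => K; rewrite fpowersetE; apply/idP/imfsetP => /= [KL|[J JL ->]].
    exists (gset act g K); last by rewrite -gsetM mulVg gset1.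
    rewrite fpowersetE -[L](gset1 act) -(mulgV g) gsetM.
    exact: gsetS.
  by apply: gsetS; rewrite -fpowersetE.
rewrite big_imfset /=; last by move=> K K' _ _; exact: gset_inj.
rewrite big_seq_fsetE /=; apply: eq_bigr => K _; congr (_ ^+ _ * _).
  have -> : gset act g^-1%g L `\` gset act g^-1%g (val K) =
      gset act g^-1%g (L `\` val K).
    by apply/fsetP => x; rewrite !inE !mem_gset !inE.
  by rewrite [RHS]card_imfset //=; exact: can_inj (lactK act g^-1%g).
by rewrite /act0 gconf_restr invgK.
Qed.

(* A finite set stabilised by [g] contains a finite [g]-orbit. *)
Lemma gset_stabilizer g L : torsion_free G -> free_action act ->
  L != fset0 -> gset act g L = L -> g = 1%g.
Proof.
move=> tf fr /fset0Pn[x xL] gL.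
have nL n : act (g ^+ n)%g x \in L.
  elim: n => [|n IH]; first by rewrite expg0 lact1.
  by rewrite expgS lactM -gL mem_gset lactK.
(* There is one more exponent than points in [L], so two of the points [g^i x] coincide. *)
have : ~~ injectiveb (fun i : 'I_#|` L|.+1 => [` nL i] : L).
  apply/negP => /injectiveP/leq_card; rewrite card_ord -cardfE.
  by rewrite ltnn.
case/injectivePn => i [j ij /(congr1 val) /= E0].
wlog lij : i j ij E0 / (i < j)%N.
  move=> H; have [|ji|/val_inj] := ltngtP i j; first exact: H.
    by apply: (H j i) => //; rewrite eq_sym.
  by move/eqP: ij.
apply: (tf g (j - i)%N); first by rewrite subn_gt0.
apply: (fr _ (act (g ^+ i)%g x)).
by rewrite -lactM -expgnDr subnK ?(ltnW lij).
Qed.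

(** Some set of representatives is needed because the isomorphism is asserted without one. Choosing
    as a function of the whole orbit makes its members share a representative. *)
Lemma orbit_reps_exist : exists I0, orbit_reps act I0.
Proof.
pose orb L : set {fset X} := [set L' | exists g, L' = gset act g L]%classic.
have orbE g L : orb (gset act g L) = orb L.
  apply/seteqP; split=> L' [h ->]; first by exists (h * g)%g; rewrite gsetM.
  by exists (h * g^-1)%g; rewrite -gsetM mulgVK.
have orbL L : orb L L by exists 1%g; rewrite gset1.
pose rep L := xget fset0 (orb L).
have repP L : orb L (rep L) by exact: (xgetI fset0 (orbL L)).
exists [set L | L != fset0 /\ L = rep L]%classic; split=> [L []//|L L0].
have [g gE] := repP L; exists (rep L); split.
  split; last by exists g^-1%g; rewrite gE -gsetM mulVg gset1.
  split; last by rewrite {2}gE /rep orbE.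
  by rewrite gE -(gset0 g) (inj_eq (@gset_inj g)).
by move=> L' [[_ L'E] [h ->]]; rewrite [RHS]L'E /rep orbE.
Qed.

End Equivariance.

(** * Cocycles become trivial in co-local functions *)

Section CocycleTrivialization.
Variables (R : realFieldType) (X : choiceType) (E : locale X).
Variables (S : finType) (s0 : S) (phi : interaction S) (nu : full_prob R S).
Variables (G : groupType) (act : locale_action G E).
Hypotheses (tf : torsion_free G) (fr : free_action act).
Variables (I0 : set {fset X}) (I0P : orbit_reps act I0).

(** [c L] carries the representative of the orbit to [L]. It is unique because stabilisers are
    trivial, and uniqueness yields equivariance. *)
Lemma orbit_coordinate : exists c : {fset X} -> G,
  (forall L, I0 L -> c L = 1%g) /\
  (forall g L, L != fset0 -> c (gset act g L) = (g * c L)%g).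
Proof.
have [I0n I0ex] := I0P.
have [L|c cP] := choice (P := fun L g => L != fset0 -> I0 (gset act g^-1%g L)).
  have [->|L0] := eqVneq L fset0; first by exists 1%g.
  have [L1 [[IL1 [g ->]] _]] := I0ex L L0; exists g => _.
  by rewrite -gsetM mulVg gset1.
have uniq g h L : L != fset0 -> I0 (gset act g^-1%g L) ->
    I0 (gset act h^-1%g L) -> g = h.
  move=> L0 Ig Ih; have [L1 [_ L1u]] := I0ex L L0.
  have Lg k : L = gset act k (gset act k^-1%g L) by rewrite -gsetM mulgV gset1.
  have /L1u e1 : I0 (gset act g^-1%g L) /\ exists k, L = gset act k (gset act g^-1%g L).
    by split=> //; exists g.
  have /L1u e2 : I0 (gset act h^-1%g L) /\ exists k, L = gset act k (gset act h^-1%g L).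
    by split=> //; exists h.
  have : (h * g^-1)%g = 1%g.
    by apply: (gset_stabilizer tf fr L0); rewrite gsetM -e1 e2 -Lg.
  by move=> e; rewrite -[LHS]mul1g -e mulgVK.
have g0 g L : L != fset0 -> gset act g L != fset0.
  by rewrite -{2}(gset0 act g) (inj_eq (@gset_inj _ _ _ act g)).
exists c; split=> [L IL|g L L0].
  have L0 := I0n L IL; apply: (uniq _ _ L) => //; first exact: cP.
  by rewrite invg1 gset1.
apply: (uniq _ _ (gset act g L)); [exact: g0 | exact/cP/g0 |].
by rewrite -gsetM invgM mulgVK; exact: cP.
Qed.

(* Comparing local parts, [theta - g theta = rho g] reads
   [theta_L - g theta_(g^-1 L) = (rho g)_L].  As [G] acts freely on nonempty
   finite sets, it is solved by [theta_(g L0) = (rho g)_(g L0)], [L0] in [I0]. *)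
Lemma cocycle_trivialization
    (rho : subspace (cocycle (gact_H0col act phi nu))) :
  exists2 theta : subspace (C0col nu),
    forall L, I0 L -> forall eta, local_part (inc theta) L eta = 0 &
    forall g, inc (inc rho g) = theta - gact_C0col act nu g theta.
Proof.
have [c [c1 cM]] := orbit_coordinate.
have /cocycleP rhoM := valP rho.
pose r g : cochain0 R X S := inc (inc (inc rho g)).
have rC g : r g \in C0col nu by exact: valP.
have rM g h : r (g * h)%g = r g + act0 act g (r h).
  by rewrite /r; have := congr1 (fun v => inc (inc v)) (rhoM g h).
have r1 : r 1%g = 0.
  have := rM 1%g 1%g; rewrite mulg1 (gact1 (gact_cochain0 act S R)).
  by move/eqP; rewrite -{1}[r 1%g]addr0 => /eqP/addrI/esym.
pose u : cochain0 R X S := fun L eta =>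
  if L == fset0 then 0 else local_part (r (c L)) L eta.
have u0 eta : u fset0 eta = 0 by rewrite /u eqxx.
have upure : pure nu u.
  move=> M N h MN eta; have [N0|N0] := boolP (N == fset0).
    by rewrite /condexp /u N0 big1 ?mulr0 // => z _; rewrite mul0r.
  rewrite /u (negbTE N0); exact: (local_part_pure s0 (rC _)).
pose theta := Subspace (sum_parts_colocal s0 u0 upure).
have lt L eta : local_part (inc theta) L eta = u L eta.
  exact: local_part_sum_parts.
exists theta => [L IL eta|g].
  by rewrite lt /u c1 // r1; case: ifP => // _; rewrite /local_part big1 // => K _; rewrite mulr0.
apply: val_inj; apply: functional_extensionality_dep => L; apply/funext => eta.
apply/eqP; rewrite -subr_eq0; apply/eqP.
(* Co-local functions are compared through the local parts of their difference. *)
pose D : cochain0 R X S := r g - (inc theta - act0 act g (inc theta)).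
apply: (local_part_eq0 s0 (f := D)) => {}L {}eta.
have [xi <-] := restr_surj s0 eta.
rewrite !local_partB local_part_act0 !lt.
have [L0|L0] := eqVneq L fset0.
  subst L; rewrite local_part_fset0 // (colocal_fset0 _ (rC g)).
  by rewrite /u gset0 !eqxx !subr0.
have gL0 : gset act g^-1%g L != fset0.
  by rewrite -(gset0 act g^-1%g) (inj_eq (@gset_inj _ _ _ act g^-1%g)).
rewrite /u (negbTE L0) (negbTE gL0) cM // -local_part_act0 -!local_partB.
(* The coordinate of [g^-1 L] is [g^-1 * c L], so the cocycle identity at [g] and [g^-1 * c L]
   closes the equation. *)
have -> : r (c L) = r g + act0 act g (r (g^-1 * c L)%g).
  by rewrite -rM mulVKg.
by rewrite addrK subrr /local_part big1 // => K _; rewrite mulr0.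
Qed.

End CocycleTrivialization.

Theorem theorem4p4 (R : realType) (X : choiceType) (E : locale X)
    (S : finType) (S_nonempty : (0 < #|S|)%N) (phi : interaction S)
    (nu : full_prob R S) (G : groupType) (act : locale_action G E)
    (G_torsion_free : torsion_free G) (act_free : free_action act) :
  exists delta : {linear Z1colG act phi nu -> H1H0col act phi nu},
  [/\ is_boundary (dcol_equivariant act phi nu) delta,
      exists2 psi : {linear quotient (dC0colG act phi nu) ->
                            H1H0col act phi nu},
        bijective psi &
        forall w, psi (qclass (dC0colG act phi nu) w) = delta w &
      forall I0 : set {fset X}, orbit_reps act I0 ->
      exists s : {linear H1H0col act phi nu -> Z1colG act phi nu},
      [/\ forall c, delta (s c) = c,
          forall c, exists2 theta, dcol E phi nu theta = inc (s c) &
            forall L, I0 L -> forall eta, local_part (inc theta) L eta = 0 &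
          exists2 dec : {linear (subspace (dC0colG act phi nu) *
                                 H1H0col act phi nu)%type ->
                                Z1colG act phi nu},
            bijective dec &
            forall b c, dec (b, c) = inc b + s c]].
Proof.
have /card_gt0P[s0 _] := S_nonempty.
(* The normalisation attached to [I0]; it is a linear condition, as a linear splitting requires. *)
pose T (I0 : set {fset X}) := [set theta : subspace (C0col nu) |
  forall L, I0 L -> forall eta, local_part (inc theta) L eta = 0]%classic.
have T0 I0 : T I0 0.
  by move=> L _ eta; rewrite /local_part big1 // => K _; rewrite mulr0.
have Tlin I0 a f g : T I0 f -> T I0 g -> T I0 (a *: f + g).
  move=> fT gT L IL eta.
  transitivity (a * local_part (inc f) L eta + local_part (inc g) L eta).
    exact: local_partP (inc f) (inc g) L eta.
  by rewrite fT // gT // mulr0 addr0.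
exact_no_check (connecting_decomposition (@dcol_surjective R X E S phi nu)
  (orbit_reps_exist act) T0 Tlin
  (fun I0 I0P => cocycle_trivialization s0 G_torsion_free act_free I0P)).
Qed.
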